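(* Let $(V,g,J)$ be a complex Euclidean vector space of complex dimension $m\geq 2$ and let $R$ be a Kähler algebraic curvature operator on $V$. Put $$\alpha_m=\frac{3m^3-m+2}{2m},\qquad \beta_m=\frac{3m^3+2m^2-3m-2}{2m},\qquad \gamma_m=\frac{3m^2+2m-1}{2}.$$ Then the following statements hold: (1) If $R$ has $\frac{3}{2}(m^2-1)$-nonnegative (respectively, $\frac{3}{2}(m^2-1)$-nonpositive) curvature operator of the second kind, then $R$ has constant nonnegative (respectively, nonpositive) holomorphic sectional curvature. (2) If $R$ has $\alpha_m$-nonnegative (respectively, $\alpha_m$-positive, $\alpha_m$-nonpositive, $\alpha_m$-negative) curvature operator of the second kind, then $R$ has nonnegative (respectively, positive, nonpositive, negative) orthogonal bisectional curvature and nonnegative (respectively, positive, nonpositive, negative) holomorphic sectional curvature. (3) If $R$ has $\beta_m$-nonnegative (respectively, $\beta_m$-positive, $\beta_m$-nonpositive, $\beta_m$-negative) curvature operator of the second kind, then $R$ has nonnegative (respectively, positive, nonpositive, negative) orthogonal Ricci curvature. (4) If $R$ has $\gamma_m$-nonnegative (respectively, $\gamma_m$-positive, $\gamma_m$-nonpositive, $\gamma_m$-negative) curvature operator of the second kind, then the expression $$2\operatorname{Ric}(X,X)-R(X,JX,X,JX)/|X|^2$$ is nonnegative (respectively, positive, nonpositive, negative) for any $0\neq X\in V$.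
   Context: A complex Euclidean vector space $(V,g,J)$ of complex dimension $m$ is a real inner product space $(V,g)$ of real dimension $2m$ with an endomorphism $J$ satisfying $J^2=-\operatorname{id}$ and $g(JX,JY)=g(X,Y)$. An algebraic curvature operator on $V$ is a 4-linear form $R$ on $V$ with $R(X,Y,Z,W)=-R(Y,X,Z,W)=-R(X,Y,W,Z)=R(Z,W,X,Y)$ and satisfying the first Bianchi identity $R(X,Y,Z,W)+R(Y,Z,X,W)+R(Z,X,Y,W)=0$. It is called Kähler if moreover $R(X,Y,Z,W)=R(X,Y,JZ,JW)$ for all $X,Y,Z,W\in V$. The sign convention is that $R(X,Y,X,Y)$ is the sectional curvature for orthonormal $X,Y$, and $\operatorname{Ric}(X,Y)=\sum_a R(X,E_a,Y,E_a)$ for an orthonormal basis $\{E_a\}$ of $V$. Let $n=2m$, let $S^2_0(V)$ be the space of traceless symmetric two-tensors on $V$ with inner product $\langle A,B\rangle=\operatorname{tr}(A^TB)$, and $N=\dim S^2_0(V)=\frac{(n-1)(n+2)}{2}$. The curvature operator of the second kind of $R$ is the symmetric bilinear form on $S^2_0(V)$ given in an orthonormal basis of $V$ by $\mathring{R}(\varphi,\psi)=\sum_{i,j,k,l=1}^n R_{ijkl}\varphi_{il}\psi_{jk}$. For a real $\alpha\in[1,N]$, $R$ has $\alpha$-nonnegative (respectively, $\alpha$-positive) curvature operator of the second kind if for every orthonormal basis $\{\varphi_i\}_{i=1}^N$ of $S^2_0(V)$, $$\sum_{i=1}^{\lfloor\alpha\rfloor}\mathring{R}(\varphi_i,\varphi_i)+(\alpha-\lfloor\alpha\rfloor)\mathring{R}(\varphi_{\lfloor\alpha\rfloor+1},\varphi_{\lfloor\alpha\rfloor+1})\geq0\quad(\text{respectively,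 }>0),$$ where the last term is absent when $\alpha$ is an integer; $R$ has $\alpha$-nonpositive (respectively, $\alpha$-negative) curvature operator of the second kind if $-R$ has $\alpha$-nonnegative (respectively, $\alpha$-positive) curvature operator of the second kind. $R$ has nonnegative (positive, nonpositive, negative) holomorphic sectional curvature if $R(X,JX,X,JX)$ is $\geq0$ ($>0$, $\leq0$, $<0$) for all nonzero $X\in V$; it has constant holomorphic sectional curvature $c$ if $R(X,JX,X,JX)=c$ for all unit $X$. $R$ has nonnegative (positive, nonpositive, negative) orthogonal bisectional curvature if $R(X,JX,Y,JY)$ is $\geq0$ ($>0$, $\leq0$, $<0$) for all nonzero $X,Y\in V$ with $g(X,Y)=g(X,JY)=0$. $R$ has nonnegative (positive, nonpositive, negative) orthogonal Ricci curvature if $\operatorname{Ric}^\perp(X,X):=\operatorname{Ric}(X,X)-R(X,JX,X,JX)/|X|^2$ is $\geq0$ ($>0$, $\leq0$, $<0$) for all nonzero $X\in V$. *)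

(* Defs.v *)
From HB Require Import structures.
From mathcomp Require Import all_boot all_order all_algebra.
From mathcomp Require Import reals.

Set Implicit Arguments.
Unset Strict Implicit.
Unset Printing Implicit Defensive.

Import Order.TTheory GRing.Theory Num.Theory.
Local Open Scope ring_scope.

(* A real inner product on V is an element of {dot V for idfun}: a bilinear,
   symmetric (hermitian for the identity conjugation), positive definite form. *)

Definition complex_structure (R : realType) (V : vectType R)
    (g : {dot V for idfun}) (J : 'End(V)) : Prop :=
  (forall X, J (J X) = - X) /\ (forall X Y, g (J X) (J Y) = g X Y).

Definition onb (R : realType) (V : vectType R) (g : {dot V for idfun})
    (n : nat) (e : n.-tuple V) : Prop :=
  basis_of {:V} e /\ orthonormal g e.

Definition four_linear (R : realType) (V : vectType R)
    (Rm : V -> V -> V -> V -> R) : Prop :=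
  [/\ forall Y Z W, scalar (fun X => Rm X Y Z W),
      forall X Z W, scalar (fun Y => Rm X Y Z W),
      forall X Y W, scalar (fun Z => Rm X Y Z W)
    & forall X Y Z, scalar (fun W => Rm X Y Z W)].

Definition algebraic_curvature (R : realType) (V : vectType R)
    (Rm : V -> V -> V -> V -> R) : Prop :=
  [/\ four_linear Rm,
      forall X Y Z W, Rm X Y Z W = - Rm Y X Z W,
      forall X Y Z W, Rm X Y Z W = - Rm X Y W Z,
      forall X Y Z W, Rm X Y Z W = Rm Z W X Y
    & forall X Y Z W, Rm X Y Z W + Rm Y Z X W + Rm Z X Y W = 0].

Definition kahler_curvature (R : realType) (V : vectType R) (J : 'End(V))
    (Rm : V -> V -> V -> V -> R) : Prop :=
  algebraic_curvature Rm /\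
  (forall X Y Z W, Rm X Y Z W = Rm X Y (J Z) (J W)).

Definition opp_curvature (R : realType) (V : vectType R)
    (Rm : V -> V -> V -> V -> R) : V -> V -> V -> V -> R :=
  fun X Y Z W => - Rm X Y Z W.

(* Two-tensors on V are given by their n x n matrices of components in an
   orthonormal basis e of V; S20 is then the space of traceless symmetric
   two-tensors, see mem_S20. The type R^o is R seen as a vector space. *)
Definition S20 (R : realType) (n : nat) : {vspace 'M[R]_n} :=
  (lker (linfun (trmx \- idfun : 'M[R]_n -> 'M[R]_n)) :&:
   lker (linfun (mxtrace : 'M[R]_n -> R^o)))%VS.

Lemma mem_S20 (R : realType) (n : nat) (A : 'M[R]_n) :
  A \in S20 R n <-> A^T = A /\ \tr A = 0.
Proof.
rewrite memv_cap !memv_ker !lfunE /= subr_eq0.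
by split=> [/andP[/eqP ? /eqP ?]|[-> ->]]; rewrite ?eqxx.
Qed.

Definition S20_dot (R : realType) (n : nat) (A B : 'M[R]_n) : R :=
  \tr (A^T *m B).

Definition S20_dim (n : nat) : nat := ((n - 1) * (n + 2)) %/ 2.

Definition S20_onb (R : realType) (n : nat)
    (phi : (S20_dim n).-tuple 'M[R]_n) : Prop :=
  basis_of (S20 R n) phi /\
  (forall i j, S20_dot (tnth phi i) (tnth phi j) = (i == j)%:R).

Definition second_kind (R : realType) (V : vectType R) (n : nat)
    (e : n.-tuple V) (Rm : V -> V -> V -> V -> R) (phi psi : 'M[R]_n) : R :=
  \sum_(i < n) \sum_(j < n) \sum_(k < n) \sum_(l < n)
    Rm (tnth e i) (tnth e j) (tnth e k) (tnth e l) * phi i l * psi j k.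

(* Used only for 1 <= alpha <= S20_dim n, so that truncn is the floor and
   all indices are in range, except that phi`_(truncn alpha) is the default
   value 0 (with coefficient 0) when alpha = S20_dim n. Indices start at 0. *)
Definition alpha_sum (R : realType) (V : vectType R) (n : nat)
    (e : n.-tuple V) (Rm : V -> V -> V -> V -> R) (alpha : R)
    (phi : (S20_dim n).-tuple 'M[R]_n) : R :=
  \sum_(0 <= i < Num.truncn alpha) second_kind e Rm phi`_i phi`_i +
  (alpha - (Num.truncn alpha)%:R) *
    second_kind e Rm phi`_(Num.truncn alpha) phi`_(Num.truncn alpha).

Definition alpha_nonnegative (R : realType) (V : vectType R) (n : nat)
    (e : n.-tuple V) (alpha : R) (Rm : V -> V -> V -> V -> R) : Prop :=
  forall phi, S20_onb phi -> 0 <= alpha_sum e Rm alpha phi.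

Definition alpha_positive (R : realType) (V : vectType R) (n : nat)
    (e : n.-tuple V) (alpha : R) (Rm : V -> V -> V -> V -> R) : Prop :=
  forall phi, S20_onb phi -> 0 < alpha_sum e Rm alpha phi.

Definition alpha_nonpositive (R : realType) (V : vectType R) (n : nat)
    (e : n.-tuple V) (alpha : R) (Rm : V -> V -> V -> V -> R) : Prop :=
  alpha_nonnegative e alpha (opp_curvature Rm).

Definition alpha_negative (R : realType) (V : vectType R) (n : nat)
    (e : n.-tuple V) (alpha : R) (Rm : V -> V -> V -> V -> R) : Prop :=
  alpha_positive e alpha (opp_curvature Rm).

(* Below, the sign condition P is instantiated by one of the predicates
   (>= 0), (> 0), (<= 0), (< 0), where (>= 0) x stands for x >= 0, etc. *)

Definition hol_sect_curv (R : realType) (V : vectType R) (J : 'End(V))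
    (Rm : V -> V -> V -> V -> R) (P : pred R) : Prop :=
  forall X, X != 0 -> P (Rm X (J X) X (J X)).

Definition const_hol_sect_curv (R : realType) (V : vectType R)
    (g : {dot V for idfun}) (J : 'End(V)) (Rm : V -> V -> V -> V -> R)
    (c : R) : Prop :=
  forall X, g X X = 1 -> Rm X (J X) X (J X) = c.

Definition orth_bisect_curv (R : realType) (V : vectType R)
    (g : {dot V for idfun}) (J : 'End(V)) (Rm : V -> V -> V -> V -> R)
    (P : pred R) : Prop :=
  forall X Y, X != 0 -> Y != 0 -> g X Y = 0 -> g X (J Y) = 0 ->
    P (Rm X (J X) Y (J Y)).

Definition Ric (R : realType) (V : vectType R) (n : nat) (e : n.-tuple V)
    (Rm : V -> V -> V -> V -> R) (X Y : V) : R :=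
  \sum_(a < n) Rm X (tnth e a) Y (tnth e a).

Definition orth_ric_curv (R : realType) (V : vectType R)
    (g : {dot V for idfun}) (J : 'End(V)) (n : nat) (e : n.-tuple V)
    (Rm : V -> V -> V -> V -> R) (P : pred R) : Prop :=
  forall X, X != 0 -> P (Ric e Rm X X - Rm X (J X) X (J X) / g X X).

Definition mixed_ric_curv (R : realType) (V : vectType R)
    (g : {dot V for idfun}) (J : 'End(V)) (n : nat) (e : n.-tuple V)
    (Rm : V -> V -> V -> V -> R) (P : pred R) : Prop :=
  forall X, X != 0 -> P (2 * Ric e Rm X X - Rm X (J X) X (J X) / g X X).

Definition alpha_m (R : realType) (m : nat) : R :=
  (3 * m%:R ^+ 3 - m%:R + 2) / (2 * m%:R).

Definition beta_m (R : realType) (m : nat) : R :=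
  (3 * m%:R ^+ 3 + 2 * m%:R ^+ 2 - 3 * m%:R - 2) / (2 * m%:R).

Definition gamma_m (R : realType) (m : nat) : R :=
  (3 * m%:R ^+ 2 + 2 * m%:R - 1) / 2.

(* Orthonormal bases exist, so fixing one is no restriction. *)
Lemma onb_exists (R : realType) (V : vectType R) (g : {dot V for idfun})
    (n : nat) : \dim {:V} = n -> exists e : n.-tuple V, onb g e.
Proof.
move=> dimV.
have gC x y : g x y = g y x by rewrite hermC expr0 mul1r.
have gl y : {morph g^~ y : a b / a + b} by move=> a b; rewrite linearDl.
have gBl x x' y : g (x - x') y = g x y - g x' y by rewrite linearBl.
have gZl a x y : g (a *: x) y = a * g x y by rewrite linearZl_LR.
have gsum k (F : 'I_k -> V) y : g (\sum_i F i) y = \sum_i g (F i) y.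
  by apply: (big_morph (g^~ y) (gl y)); rewrite linear0l.
suff [s [ss fs os]] : exists s : seq V, [/\ size s = n, free s & orthonormal g s].
  exists (Tuple (introT eqP ss)); split=> //=.
  by rewrite basisEfree fs subvf dimV ss /=.
have : (n <= \dim {:V})%N by rewrite dimV.
elim: {dimV} n => [|k IHk] hk; first by exists [::]; rewrite nil_free.
have [s [ss fs os]] := IHk (ltnW hk).
have [v vNs] : exists v, v \notin <<s>>%VS.
  suff /subvPn[v _ ?] : ~~ ({:V} <= <<s>>)%VS by exists v.
  by apply: contraL hk => /dimvS; rewrite (eqP fs) ss -leqNgt.
have [n1 on] := andP os.
have orth i j : (i < size s)%N -> (j < size s)%N -> g s`_i s`_j = (i == j)%:R.
  move: n1 on {ss fs vNs os}.
  elim: s i j => [|x s IHs] //= [|i] [|j] /= /andP[/eqP x1 s1] /andP[xs os] hi hj.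
  - exact: x1.
  - by move: xs => /andP[/allP/(_ _ (mem_nth 0 hj))/eqP ->].
  - rewrite gC.
    by move: xs => /andP[/allP/(_ _ (mem_nth 0 hi))/eqP ->].
  - by rewrite IHs //; case/andP: os.
pose w := v - \sum_(i < size s) g v s`_i *: s`_i.
have sum_s : \sum_(i < size s) g v s`_i *: s`_i \in <<s>>%VS.
  by apply: memv_suml => i _; rewrite memvZ // memv_span // mem_nth.
have wNs : w \notin <<s>>%VS by rewrite /w rpredBr.
have w0 : w != 0 by apply: contraNneq wNs => ->; rewrite mem0v.
have ws j : (j < size s)%N -> g w s`_j = 0.
  move=> hj; rewrite /w gBl gsum (bigD1 (Ordinal hj)) //= big1 => [|i ij].
    by rewrite gZl orth // eqxx mulr1 addr0 subrr.
  by rewrite gZl orth // (negPf ij : (i == j :> nat) = false) mulr0.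
have gw : 0 < g w w by exact: neq0_dnorm_gt0.
pose c := (Num.sqrt (g w w))^-1.
have c0 : c != 0 by rewrite invr_eq0 gt_eqF // sqrtr_gt0.
exists (c *: w :: s); split.
- by rewrite /= ss.
- rewrite free_cons fs andbT; apply: contra wNs => cw.
  by rewrite -[w]scale1r -(mulVf c0) -scalerA memvZ.
- rewrite /orthonormal /= n1 on !andbT; apply/andP; split.
    rewrite gZl gC gZl mulrA -expr2 exprVn sqr_sqrtr ?ltW // mulVf //.
    by rewrite gt_eqF.
  apply/allP => x /(nthP 0)[j hj <-] /=.
  by rewrite gZl ws // mulr0.
Qed.

(* Main.v *)
Require Import Defs.
From mathcomp Require Import all_boot all_order all_algebra.
From mathcomp Require Import ring lra zify reals.

(** On S^2_0(V) write Q for the curvature operator of the second kind and split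
    off the m(m+1)-dimensional space of tensors anticommuting with J. For every
    Kaehler R the trace of Q is the scalar curvature S on this space and
    -(m-1)/(2m) S on its (m^2-1)-dimensional complement of J-invariant tensors.
    Hence the weights 1 on the complement and (m-1)/(2m) on the anti-invariant
    space, of total mass 3/2 (m^2-1), make the weighted trace of Q vanish.
    Raising the weight to 1 on a d-dimensional anti-invariant subspace E adds
    d (m+1)/(2m) to the mass and (m+1)/(2m) tr_E Q to the trace, so that for
    alpha = 3/2 (m^2-1) + d (m+1)/(2m) some alpha-sum is at most (m+1)/(2m) tr_E Q.
    Let A(X,Y) be the anti-invariant part of X.Y, for which
    Q(A(X,Y),A(X,Y)) = 2 R(X,JX,Y,JY). The subspaces spanned by A(X,X), A(X,JX)
    (d = 2), by A(X,Y), A(X,JY) (d = 2), by A(X,Y) with Y orthogonal to X, JX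
    (d = 2m-2), and by all A(X,Y) (d = 2m) give parts (2), (3) and (4). Part (1)
    is the equality case d = 0, in which the weights may be perturbed. *)

Set Implicit Arguments.
Unset Strict Implicit.
Unset Printing Implicit Defensive.

Import Order.TTheory GRing.Theory Num.Theory.
Local Open Scope ring_scope.

(** * Linear functionals *)

Section Scalar.
Variables (R : realType) (V : vectType R) (f : V -> R).
Hypothesis fl : scalar f.

Lemma scalar_add x y : f (x + y) = f x + f y.
Proof. by have := fl 1 x y; rewrite scale1r mul1r. Qed.

Lemma scalar_zero : f 0 = 0.
Proof. by apply: (addrI (f 0)); rewrite -scalar_add !addr0. Qed.

Lemma scalar_scale a x : f (a *: x) = a * f x.
Proof. by have := fl a x 0; rewrite scalar_zero !addr0. Qed.

Lemma scalar_opp x : f (- x) = - f x.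
Proof. by rewrite -scaleN1r scalar_scale mulN1r. Qed.

Lemma scalar_sum I (r : seq I) (F : I -> V) :
  f (\sum_(i <- r) F i) = \sum_(i <- r) f (F i).
Proof. by apply: (big_morph f scalar_add); rewrite scalar_zero. Qed.

Lemma scalar_comb I (r : seq I) (c : I -> R) (F : I -> V) :
  f (\sum_(i <- r) c i *: F i) = \sum_(i <- r) c i * f (F i).
Proof. by rewrite scalar_sum; apply: eq_bigr => i _; rewrite scalar_scale. Qed.

End Scalar.

(** * Orthonormal sequences and traces in an inner product space *)

Definition inner_product (R : realType) (V : vectType R) (d : V -> V -> R) :=
  [/\ forall y, scalar (d^~ y), forall x y, d x y = d y x
    & forall x, x != 0 -> 0 < d x x].

(** The second condition only sees membership and would admit a repeated unit vector, hence the
    explicit [uniq]. *)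
Definition orthonormal_seq (R : realType) (V : vectType R) (d : V -> V -> R)
    (s : seq V) :=
  uniq s /\ {in s &, forall x y, d x y = (x == y)%:R}.

Lemma orthonormal_seq_map (R : realType) (V W : vectType R) (d : V -> V -> R)
    (d' : W -> W -> R) (f : V -> W) (s : seq V) :
  {in s &, forall x y, d' (f x) (f y) = d x y} ->
  orthonormal_seq d s -> orthonormal_seq d' (map f s).
Proof.
move=> df [us ds].
(* Two members with the same image have product 1, whereas distinct members have product 0. *)
have finj : {in s &, injective f}.
  move=> x y xs ys fxy; apply/eqP; move: (df _ _ xs ys).
  rewrite -fxy df // !ds // eqxx; case: (x == y) => // /eqP.
  by rewrite oner_eq0.
split; first by rewrite map_inj_in_uniq.
move=> _ _ /mapP[x xs ->] /mapP[y ys ->].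
by rewrite df // ds // (inj_in_eq finj).
Qed.

Section InnerProduct.
Variables (R : realType) (V : vectType R) (d : V -> V -> R).
Hypothesis ip : inner_product d.
Implicit Types (s t : seq V) (U : {vspace V}).

Lemma ip_scalarl y : scalar (d^~ y). Proof. by case: ip. Qed.

Lemma ipC x y : d x y = d y x. Proof. by case: ip. Qed.

Lemma ip_gt0 x : x != 0 -> 0 < d x x. Proof. by case: ip => _ _; apply. Qed.

Lemma ip_eq0 x : d x x = 0 -> x = 0.
Proof.
by move=> dx; apply/eqP; apply: contraTT isT => /ip_gt0; rewrite dx ltxx.
Qed.

Lemma ip_scalarr x : scalar (d x).
Proof. by move=> a u v; rewrite !(ipC x); exact: ip_scalarl. Qed.

Lemma orthonormal_seq_nil : orthonormal_seq d [::].
Proof. by []. Qed.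

Lemma orthonormal_seq_cat s t :
  orthonormal_seq d s -> orthonormal_seq d t ->
  (forall x y, x \in s -> y \in t -> d x y = 0) ->
  orthonormal_seq d (s ++ t).
Proof.
move=> [us ds] [ut dt] st.
have sNt x : x \in s -> x \notin t.
  move=> xs; apply/negP => xt; have := st x x xs xt.
  by rewrite ds // eqxx => /eqP; rewrite oner_eq0.
have neq x y : x \in s -> y \in t -> (x == y) = false.
  by move=> /sNt xt yt; apply: contraNF xt => /eqP ->.
split.
  rewrite cat_uniq us ut andbT /=; apply/hasPn => x xt.
  by apply: contraL xt => /sNt.
move=> x y; rewrite !mem_cat => /orP[xs|xt] /orP[ys|yt].
- exact: ds.
- by rewrite st // neq.
- by rewrite ipC st // eq_sym neq.
- exact: dt.
Qed.

Lemma orthonormal_seq1 x : d x x = 1 -> orthonormal_seq d [:: x].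
Proof.
by move=> dx; split=> // y z; rewrite !inE => /eqP -> /eqP ->; rewrite dx eqxx.
Qed.

Lemma orthonormal_seq2 x y : d x x = 1 -> d y y = 1 -> d x y = 0 ->
  orthonormal_seq d [:: x; y].
Proof.
move=> dx dy dxy; apply: (@orthonormal_seq_cat [:: x] [:: y]).
- exact: orthonormal_seq1.
- exact: orthonormal_seq1.
- by move=> u v; rewrite !inE => /eqP -> /eqP ->.
Qed.

Lemma orthonormal_seq_catr s t :
  orthonormal_seq d (s ++ t) -> orthonormal_seq d t.
Proof.
move=> [u h]; split; first by move: u; rewrite cat_uniq => /and3P[].
by move=> x y xs ys; rewrite h // mem_cat ?xs ?ys orbT.
Qed.

Lemma orthonormal_seq_cat0 s t x y :
  orthonormal_seq d (s ++ t) -> x \in s -> y \in t -> d x y = 0.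
Proof.
move=> [u h] xs yt; rewrite h ?mem_cat ?xs ?yt ?orbT //.
case: eqP => // xy; move: u; rewrite cat_uniq => /and3P[_ /hasPn/(_ _ yt)].
by rewrite -xy xs.
Qed.

Lemma orthonormal_seq_perm s t :
  perm_eq s t -> orthonormal_seq d s -> orthonormal_seq d t.
Proof.
move=> st [us ds]; split; first by rewrite -(perm_uniq st).
by move=> x y; rewrite -!(perm_mem st); exact: ds.
Qed.

Lemma orthonormal_seq_sum s (f : V -> R) y : orthonormal_seq d s -> y \in s ->
  \sum_(x <- s) f x * d x y = f y.
Proof.
move=> [us ds] ys; rewrite (bigD1_seq y) //= ds // eqxx mulr1.
rewrite big_seq_cond big1 ?addr0 // => x /andP[xs /negPf xy].
by rewrite ds // xy mulr0.
Qed.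

Lemma span_orthogonal s v u : (forall y, y \in s -> d y u = 0) ->
  v \in <<s>>%VS -> d v u = 0.
Proof.
move=> su; rewrite -[s]/(tval (in_tuple s)) => /coord_span ->.
rewrite (scalar_sum (ip_scalarl u)) big1 // => i _.
by rewrite (scalar_scale (ip_scalarl u)) su ?mulr0 // mem_nth.
Qed.

Lemma residual_orthogonal s v y : orthonormal_seq d s -> y \in s ->
  d (v - \sum_(x <- s) d v x *: x) y = 0.
Proof.
move=> os ys; rewrite (scalar_add (ip_scalarl y)) (scalar_opp (ip_scalarl y)).
rewrite (scalar_comb (ip_scalarl y)).
by rewrite (orthonormal_seq_sum (fun x => d v x) os ys) subrr.
Qed.

Lemma span_comb s (c : V -> R) : \sum_(x <- s) c x *: x \in <<s>>%VS.
Proof.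
rewrite big_seq; apply: memv_suml => x xs.
by rewrite memvZ // memv_span.
Qed.

(** The difference of the two sides lies in the span of s and is orthogonal to s, hence to
    itself. *)
Lemma orthonormal_expand s v : orthonormal_seq d s -> v \in <<s>>%VS ->
  v = \sum_(x <- s) d v x *: x.
Proof.
move=> os vs; apply/eqP; rewrite -subr_eq0; apply/eqP/ip_eq0.
apply: (@span_orthogonal s) => [y ys|].
  by rewrite ipC residual_orthogonal.
by rewrite rpredB // span_comb.
Qed.

Lemma orthonormal_free s : orthonormal_seq d s -> free s.
Proof.
elim: s => [|x s IHs] os; first exact: nil_free.
have os' := orthonormal_seq_catr (os : orthonormal_seq d ([:: x] ++ s)).
rewrite free_cons IHs // andbT; apply/negP => xs.
suff : d x x = 0.
  by case: os => _ ->; rewrite ?mem_head // eqxx => /eqP; rewrite oner_eq0.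
apply: span_orthogonal xs => y ys; rewrite ipC.
apply: (orthonormal_seq_cat0 (os : orthonormal_seq d ([:: x] ++ s))) => //.
exact: mem_head.
Qed.

(** Gram-Schmidt, by induction on the codimension [\dim U - size s]: as long as some v in U is
    outside the span, its normalised residual is appended. *)
Lemma orthonormal_extend U s : orthonormal_seq d s -> {subset s <= U} ->
  exists t, orthonormal_seq d (s ++ t) /\ basis_of U (s ++ t).
Proof.
have [k] := ubnP (\dim U - size s)%N.
elim: k s => // k IHk s; rewrite ltnS => hk os sU.
have sUV : (<<s>> <= U)%VS by apply/span_subvP.
have [Us|/subvPn[v vU vNs]] := boolP (U <= <<s>>)%VS.
  exists [::]; rewrite cats0; split=> //.
  rewrite basisEfree orthonormal_free // sUV /=.
  by rewrite -(eqP (orthonormal_free os)) dimvS.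
pose w := v - \sum_(x <- s) d v x *: x.
have wNs : w \notin <<s>>%VS by rewrite rpredBr // span_comb.
have w0 : w != 0 by apply: contraNneq wNs => ->; rewrite mem0v.
have dw := ip_gt0 w0.
pose c := (Num.sqrt (d w w))^-1.
have oc : orthonormal_seq d (s ++ [:: c *: w]).
  apply: orthonormal_seq_cat => //.
    apply: orthonormal_seq1.
    rewrite (scalar_scale (ip_scalarl _)) (scalar_scale (ip_scalarr _)) mulrA.
    by rewrite -expr2 exprVn sqr_sqrtr ?ltW // mulVf // gt_eqF.
  move=> x y xs; rewrite inE => /eqP ->.
  by rewrite (scalar_scale (ip_scalarr _)) ipC residual_orthogonal // mulr0.
have cU : {subset s ++ [:: c *: w] <= U}.
  move=> x; rewrite mem_cat inE => /orP[/sU //|/eqP ->].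
  by rewrite memvZ // rpredB //; apply: (subvP sUV); apply: span_comb.
have [|t ot] := IHk _ _ oc cU.
  have : (size (s ++ [:: c *: w]) <= \dim U)%N.
    by rewrite -(eqP (orthonormal_free oc)); apply/dimvS/span_subvP.
  rewrite size_cat /= addn1 => ltU; apply: leq_trans hk.
  by rewrite subnS prednK // subn_gt0.
by exists (c *: w :: t); rewrite -cat1s catA.
Qed.

Lemma basis_orthonormal_expand U s v : orthonormal_seq d s -> basis_of U s ->
  v \in U -> v = \sum_(x <- s) d v x *: x.
Proof. by move=> os /span_basis <-; exact: orthonormal_expand. Qed.

(* The trace of Q over U, computed through the orthogonal projection P onto U
   and a Parseval frame t of the whole space. *)
Lemma trace_projection U s t (P : V -> V) (Q : V -> V -> R) :
  orthonormal_seq d s -> basis_of U s ->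
  (forall v, P v \in U) -> (forall v, v \in U -> P v = v) ->
  (forall u v, d (P u) v = d u (P v)) ->
  (forall v, v = \sum_(y <- t) d v y *: y) ->
  (forall y, scalar (Q^~ y)) -> (forall x, scalar (Q x)) ->
  \sum_(x <- s) Q x x = \sum_(y <- t) Q y (P y).
Proof.
move=> os bs PU PI PA frame Ql Qr.
transitivity (\sum_(x <- s) \sum_(y <- t) d x y * Q y x).
  apply: eq_bigr => x _; rewrite {1}(frame x).
  exact: (scalar_comb (Ql x)).
rewrite exchange_big /=; apply: eq_bigr => y _.
rewrite (basis_orthonormal_expand os bs (PU y)) (scalar_comb (Qr y)).
rewrite big_seq [RHS]big_seq; apply: eq_bigr => x xs.
by rewrite PA PI ?(basis_mem bs) // ipC.
Qed.

End InnerProduct.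

(** * The trace form on matrices *)

Lemma S20_dotE (R : realType) (n : nat) (A B : 'M[R]_n) :
  S20_dot A B = \sum_i \sum_j A i j * B i j.
Proof.
rewrite /S20_dot /mxtrace exchange_big /=; apply: eq_bigr => i _.
by rewrite mxE; apply: eq_bigr => j _; rewrite mxE.
Qed.

Lemma S20_dot_tr (R : realType) (n : nat) (A B : 'M[R]_n) :
  S20_dot A^T B = S20_dot A B^T.
Proof.
rewrite !S20_dotE exchange_big; apply: eq_bigr => i _; apply: eq_bigr => j _.
by rewrite !mxE.
Qed.

Lemma S20_dot_inner_product (R : realType) (n : nat) :
  inner_product (@S20_dot R n).
Proof.
split=> [C a A B|A B|A A0].
- rewrite !S20_dotE mulr_sumr -big_split; apply: eq_bigr => i _.
  rewrite mulr_sumr -big_split; apply: eq_bigr => j _.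
  by rewrite !mxE /= mulrDl mulrA.
- rewrite !S20_dotE; apply: eq_bigr => i _; apply: eq_bigr => j _.
  exact: mulrC.
- have sq i j : 0 <= A i j * A i j by rewrite -expr2 sqr_ge0.
  have sqs i : 0 <= \sum_j A i j * A i j by apply: sumr_ge0.
  rewrite S20_dotE lt_neqAle sumr_ge0 // andbT eq_sym.
  apply: contra A0 => /eqP/psumr_eq0P A0; apply/eqP/matrixP => i j.
  have /psumr_eq0P Ai := A0 (fun i _ => sqs i) i isT.
  have /eqP := Ai (fun j _ => sq i j) j isT.
  by rewrite mulf_eq0 orbb mxE => /eqP.
Qed.

(** * Alpha-sums bounded by weighted sums *)

Section WeightedSum.
Variables (R : realType) (V : vectType R) (n : nat) (e : n.-tuple V).
Variable (Rm : V -> V -> V -> V -> R).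
Local Notation Q := (second_kind e Rm).

Lemma second_kind_scalarl B : scalar (Q^~ B).
Proof.
move=> a A C; rewrite /second_kind mulr_sumr -big_split; apply: eq_bigr => i _.
rewrite mulr_sumr -big_split; apply: eq_bigr => j _.
rewrite mulr_sumr -big_split; apply: eq_bigr => k _.
rewrite mulr_sumr -big_split; apply: eq_bigr => l _.
by rewrite !mxE /=; ring.
Qed.

Lemma second_kind_scalarr A : scalar (Q A).
Proof.
move=> a B C; rewrite /second_kind mulr_sumr -big_split; apply: eq_bigr => i _.
rewrite mulr_sumr -big_split; apply: eq_bigr => j _.
rewrite mulr_sumr -big_split; apply: eq_bigr => k _.
rewrite mulr_sumr -big_split; apply: eq_bigr => l _.
by rewrite !mxE /=; ring.
Qed.

(* Sorting the basis by increasing values of Q makes the alpha-sum the smallest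
   sum with weights in [0, 1] of total mass alpha. *)
Lemma alpha_sum_le_weighted (alpha : R) (L : seq ('M[R]_n * R)) :
  orthonormal_seq (@S20_dot R n) (unzip1 L) -> basis_of (S20 R n) (unzip1 L) ->
  size L = S20_dim n -> (forall p, p \in L -> 0 <= p.2 <= 1) ->
  \sum_(p <- L) p.2 = alpha -> alpha < (S20_dim n)%:R ->
  exists phi, S20_onb phi /\
    alpha_sum e Rm alpha phi <= \sum_(p <- L) p.2 * Q p.1 p.1.
Proof.
move=> oL bL sL wL walpha altN.
have alpha0 : 0 <= alpha.
  by rewrite -walpha big_seq sumr_ge0 // => p /wL /andP[].
pose a (p : 'M[R]_n * R) := Q p.1 p.1.
pose K := sort (relpre a <=%R) L.
have KL : perm_eq K L by rewrite /K perm_sort.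
have sK : size K = S20_dim n by rewrite (perm_size KL).
have sK1 : size (unzip1 K) == S20_dim n by rewrite size_map sK.
(* Strictness of the bound on alpha keeps the index of the fractional term in range. *)
have kN : (Num.truncn alpha < size K)%N by rewrite sK truncn_lt_nat.
set k := Num.truncn alpha in kN *.
have p0 : 'M[R]_n * R := (0, 0).
have nthE i : (i < size K)%N -> (unzip1 K)`_i = (nth p0 K i).1.
  by move=> iK; rewrite (nth_map p0).
have mono i j : (i <= j)%N -> (j < size K)%N -> a (nth p0 K i) <= a (nth p0 K j).
  move=> ij jK; have iK := leq_ltn_trans ij jK.
  have tr : transitive (relpre a <=%R) by move=> x y z; exact: le_trans.
  have rf : reflexive (relpre a <=%R) by move=> x; exact: lexx.
  have srt : sorted (relpre a <=%R) K by apply: sort_sorted => x y; exact: le_total.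
  exact: (sorted_leq_nth tr rf p0 srt i j iK jK ij).
exists (Tuple sK1); split.
  split=> [|i j]; first by rewrite /= (perm_basis _ (perm_map fst KL)).
  have [uK dK] := orthonormal_seq_perm
    (perm_map fst (etrans (perm_sym _ _) KL)) oL.
  rewrite !(tnth_nth 0) /= dK ?mem_nth ?(eqP sK1) // nth_uniq ?(eqP sK1) //.
rewrite -(perm_big _ KL) /=.
(* Both sides have total mass alpha, so subtracting [alpha * t] turns values into differences from
   t, and the fractional term disappears. Before index k the differences are nonpositive and a
   weight at most 1 can only increase them; from k on they are nonnegative. *)
pose t := a (nth p0 K k).
rewrite -(lerD2r (- (alpha * t))) /alpha_sum -/k /=.
have -> : \sum_(p <- K) p.2 * Q p.1 p.1 - alpha * t =
    \sum_(p <- K) p.2 * (a p - t).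
  rewrite -walpha -(perm_big _ KL) /= mulr_suml -sumrB.
  by apply: eq_bigr => p _; rewrite mulrBr.
have -> : \sum_(0 <= i < k) Q (unzip1 K)`_i (unzip1 K)`_i +
    (alpha - k%:R) * Q (unzip1 K)`_k (unzip1 K)`_k - alpha * t =
    \sum_(0 <= i < k) (a (nth p0 K i) - t).
  rewrite sumrB [X in _ = _ - X]big_const_nat iter_addr_0 subn0 -mulr_natl.
  rewrite nthE // -/(a _) -/t big_nat [in RHS]big_nat.
  rewrite (eq_bigr (fun i => a (nth p0 K i))) ; first by ring.
  by move=> i /andP[_ ik]; rewrite nthE // (ltn_trans ik).
have wK i : (i < size K)%N -> 0 <= (nth p0 K i).2 <= 1.
  by move=> iK; apply: wL; rewrite -(perm_mem KL) mem_nth.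
rewrite (big_nth p0) [X in _ <= X](big_cat_nat (n := k)) //= ?(ltnW kN) //.
rewrite -[X in X <= _]addr0; apply: lerD.
  rewrite big_nat [X in _ <= X]big_nat; apply: ler_sum => i /andP[_ ik].
  have /andP[_ w1] := wK i (ltn_trans ik kN).
  have at0 : a (nth p0 K i) - t <= 0.
    by rewrite subr_le0; exact: mono (ltnW ik) kN.
  by have := ler_wnM2r at0 w1; rewrite mul1r.
rewrite big_nat sumr_ge0 // => i /andP[ki iK].
have /andP[w0 _] := wK i iK.
by rewrite mulr_ge0 // subr_ge0; exact: mono.
Qed.

End WeightedSum.

(** * Tensors on V in an orthonormal basis *)

Lemma dot_inner_product (R : realType) (V : vectType R)
    (g : {dot V for idfun}) : inner_product g.
Proof.
split=> [y a u v|x y|x x0].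
- by rewrite linearDl linearZl_LR.
- by rewrite hermC expr0 mul1r.
- exact: neq0_dnorm_gt0.
Qed.

Lemma orthonormal_seq_of_orthonormal (R : realType) (V : vectType R)
    (g : {dot V for idfun}) (s : seq V) :
  orthonormal g s -> orthonormal_seq g s.
Proof.
have gip := dot_inner_product g.
elim: s => [|x s IHs]; first by [].
rewrite /orthonormal /= => /andP[/andP[x1 s1] /andP[xs os]].
apply: (@orthonormal_seq_cat _ _ g gip [:: x] s).
- by apply: orthonormal_seq1; apply/eqP.
- by apply: IHs; rewrite /orthonormal s1.
- move=> u v; rewrite inE => /eqP -> vs.
  by move: xs => /andP[/allP/(_ _ vs)/eqP ->].
Qed.

Section Tensors.
Variables (R : realType) (V : vectType R) (g : {dot V for idfun}).
Variables (n : nat) (e : n.-tuple V).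
Hypothesis onbe : onb g e.

Let gip : inner_product g := dot_inner_product g.
Let ose : orthonormal_seq g e.
Proof. by case: onbe => _ /orthonormal_seq_of_orthonormal. Qed.

Lemma onb_expand X : X = \sum_(y <- e) g X y *: y.
Proof.
case: onbe => be _; exact: (basis_orthonormal_expand gip ose be (memvf X)).
Qed.

Lemma scalar_expand (f : V -> R) X : scalar f ->
  f X = \sum_(i < n) g X (tnth e i) * f (tnth e i).
Proof. by move=> fl; rewrite {1}(onb_expand X) (scalar_comb fl) big_tuple. Qed.

Lemma onb_tnth i j : g (tnth e i) (tnth e j) = (i == j)%:R.
Proof.
case: ose => ue ->; rewrite ?mem_tnth //.
by rewrite !(tnth_nth 0) nth_uniq ?size_tuple.
Qed.

Definition components X : 'cV[R]_n := \col_i g X (tnth e i).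

(** The matrix of the tensor product of X and Y. Curvature terms and inner products are computed on
    these rank-one tensors and extended by linearity. *)
Definition tens X Y : 'M[R]_n := components X *m (components Y)^T.

Lemma tensE X Y i j : tens X Y i j = g X (tnth e i) * g Y (tnth e j).
Proof. by rewrite mxE big_ord1 !mxE. Qed.

Lemma tr_tens X Y : (tens X Y)^T = tens Y X.
Proof. by rewrite trmx_mul trmxK. Qed.

Lemma tensZl a X Y : tens (a *: X) Y = a *: tens X Y.
Proof.
by apply/matrixP => i j; rewrite [RHS]mxE !tensE (scalar_scale (ip_scalarl gip _)) mulrA.
Qed.

Lemma tensZr a X Y : tens X (a *: Y) = a *: tens X Y.
Proof. by rewrite -tr_tens tensZl linearZ /= tr_tens. Qed.

Lemma tensNl X Y : tens (- X) Y = - tens X Y.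
Proof. by rewrite -scaleN1r tensZl scaleN1r. Qed.

Lemma tensNr X Y : tens X (- Y) = - tens X Y.
Proof. by rewrite -scaleN1r tensZr scaleN1r. Qed.

Lemma mxtrace_tens X Y : \tr (tens X Y) = g X Y.
Proof.
rewrite (scalar_expand X (ip_scalarl gip Y)); apply: eq_bigr => i _.
by rewrite tensE (ipC gip Y).
Qed.

Lemma S20_dot_tens X Y Z W : S20_dot (tens X Y) (tens Z W) = g X Z * g Y W.
Proof.
rewrite /S20_dot tr_tens /tens mulmxA mxtrace_mulC !mulmxA -mulmxA.
have gE A B : (components A)^T *m components B = (g A B)%:M.
  apply/matrixP => i j; rewrite !ord1 !mxE eqxx mulr1n.
  rewrite (scalar_expand A (ip_scalarl gip B)); apply: eq_bigr => k _.
  by rewrite !mxE (ipC gip B).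
by rewrite !gE -scalar_mxM mxtrace_scalar mulr1n mulrC (ipC gip W).
Qed.

(** The first tensor is contracted with the outer slots 1 and 4 of the curvature, the second with
    the inner slots 2 and 3; hence the order of the arguments. *)
Lemma second_kind_tens (Rm : V -> V -> V -> V -> R) X Y Z W :
  four_linear Rm ->
  second_kind e Rm (tens X Y) (tens Z W) = Rm X Z W Y.
Proof.
case=> l1 l2 l3 l4.
rewrite (scalar_expand X (l1 Z W Y)); apply: eq_bigr => i _.
rewrite (scalar_expand Z (l2 _ W Y)) mulr_sumr; apply: eq_bigr => j _.
rewrite (scalar_expand W (l3 _ _ Y)) !mulr_sumr; apply: eq_bigr => k _.
rewrite (scalar_expand Y (l4 _ _ _)) !mulr_sumr; apply: eq_bigr => l _.
by rewrite !tensE; ring.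
Qed.

(** Orthonormal basis of the space of all matrices. Its members are in general neither symmetric nor
    traceless, so traces over subspaces are taken through a projection. *)
Definition tens_frame := [seq tens a b | a <- e, b <- e].

Lemma tens_frame_expand A :
  A = \sum_(y <- tens_frame) S20_dot A y *: y.
Proof.
rewrite big_allpairs_dep big_tuple.
have dE i j : tens (tnth e i) (tnth e j) = delta_mx i j.
  apply/matrixP => k l; rewrite tensE !onb_tnth mxE -natrM mulnb.
  by rewrite (eq_sym i) (eq_sym j).
rewrite {1}[A]matrix_sum_delta; apply: eq_bigr => i _.
rewrite big_tuple; apply: eq_bigr => j _; rewrite dE; congr (_ *: _).
rewrite S20_dotE (bigD1 i) //= (bigD1 j) //= mxE !eqxx mulr1.
rewrite big1 ?addr0 => [|l lj]; last by rewrite mxE (negPf lj) andbF mulr0.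
rewrite big1 ?addr0 // => k ki; rewrite big1 // => l _.
by rewrite mxE (negPf ki) mulr0.
Qed.

Lemma sum_tens_diag : \sum_(c <- e) tens c c = 1%:M.
Proof.
apply/matrixP => i j; rewrite summxE [RHS]mxE -onb_tnth.
under eq_bigr => c _ do rewrite tensE.
rewrite big_tuple [RHS](scalar_expand _ (ip_scalarl gip _)).
by apply: eq_bigr => k _; rewrite (ipC gip (tnth e k) (tnth e i)).
Qed.

Definition S20_proj (A : 'M[R]_n) : 'M[R]_n :=
  2^-1 *: (A + A^T) - (\tr A / n%:R)%:M.

Lemma S20_proj_mem A : (0 < n)%N -> S20_proj A \in S20 R n.
Proof.
move=> n0; apply/mem_S20; split.
  by rewrite linearB linearZ linearD /= trmxK tr_scalar_mx (addrC A^T).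
rewrite linearB linearZ linearD /= mxtrace_tr mxtrace_scalar -mulr_natr.
have n0' : n%:R != 0 :> R by rewrite pnatr_eq0 -lt0n.
by field.
Qed.

Lemma S20_proj_id A : A \in S20 R n -> S20_proj A = A.
Proof.
move=> /mem_S20[At A0]; rewrite /S20_proj At A0 mul0r raddf0 subr0 -mulr2n.
by rewrite -scaler_nat scalerA mulVf ?pnatr_eq0 // scale1r.
Qed.

Lemma S20_proj_selfadj A B : S20_dot (S20_proj A) B = S20_dot A (S20_proj B).
Proof.
have dip := S20_dot_inner_product R n.
have dl := ip_scalarl dip; have dr := ip_scalarr dip.
rewrite (scalar_add (dl _)) (scalar_opp (dl _)) (scalar_scale (dl _)).
rewrite (scalar_add (dl _)) (scalar_add (dr _)) (scalar_opp (dr _)).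
rewrite (scalar_scale (dr _)) (scalar_add (dr _)) S20_dot_tr; congr (_ - _).
rewrite /S20_dot tr_scalar_mx mul_scalar_mx mul_mx_scalar !mxtraceZ mxtrace_tr.
by rewrite mulrAC [RHS]mulrAC (mulrC (\tr A)).
Qed.

Lemma onb_sum_dot (F : V -> V -> R) :
  \sum_(a <- e) \sum_(b <- e) g a b * F a b = \sum_(a <- e) F a a.
Proof.
rewrite big_seq [RHS]big_seq; apply: eq_bigr => a ae.
under eq_bigr => b _ do rewrite (ipC gip a) mulrC.
exact: (orthonormal_seq_sum (fun b => F a b) ose ae).
Qed.

Lemma onb_sum_diag : \sum_(a <- e) g a a = n%:R.
Proof.
rewrite big_tuple (eq_bigr (fun=> 1)) ?sumr_const ?card_ord // => i _.
by rewrite onb_tnth eqxx.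
Qed.

(** This is [trace_projection] for [S20_proj] on the frame: symmetrisation yields the first double
    sum, removal of the trace part the second. *)
Lemma trace_S20 (s : seq 'M[R]_n) (Q : 'M[R]_n -> 'M[R]_n -> R) : (0 < n)%N ->
  orthonormal_seq (@S20_dot R n) s -> basis_of (S20 R n) s ->
  (forall y, scalar (Q^~ y)) -> (forall x, scalar (Q x)) ->
  \sum_(x <- s) Q x x =
  2^-1 * \sum_(a <- e) \sum_(b <- e)
     (Q (tens a b) (tens a b) + Q (tens a b) (tens b a))
  - n%:R^-1 * \sum_(a <- e) \sum_(b <- e) Q (tens a a) (tens b b).
Proof.
move=> n0 os bs Ql Qr.
rewrite (trace_projection (S20_dot_inner_product R n) os bs
  (fun A => S20_proj_mem A n0) S20_proj_id S20_proj_selfadj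
  tens_frame_expand Ql Qr).
(* The trace part of [tens a b] is g a b / n times the identity, which is the sum of all [tens c c].
   The diagonal sum is rewritten as a double sum with the factor g a b, so that the two sides agree
   term by term. *)
rewrite big_allpairs_dep -(onb_sum_dot (fun a b => \sum_(c <- e) Q (tens a b) (tens c c))).
rewrite !mulr_sumr -sumrB; apply: eq_bigr => a _.
rewrite !mulr_sumr -sumrB; apply: eq_bigr => b _.
rewrite (scalar_add (Qr _)) (scalar_opp (Qr _)) (scalar_scale (Qr _)).
rewrite (scalar_add (Qr _)) tr_tens mxtrace_tens -scalemx1.
rewrite (scalar_scale (Qr _)) -sum_tens_diag (scalar_sum (Qr _)).
by congr (_ - _); rewrite mulrA; congr (_ * _); rewrite mulrC.
Qed.

(** The dimension is the trace of the inner product itself, so [trace_S20] computes it. *)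
Lemma size_S20 (s : seq 'M[R]_n) : (0 < n)%N ->
  orthonormal_seq (@S20_dot R n) s -> basis_of (S20 R n) s ->
  (size s)%:R = (n%:R ^+ 2 + n%:R - 2) / 2 :> R.
Proof.
move=> n0 os bs; have dip := S20_dot_inner_product R n.
have n0' : n%:R != 0 :> R by rewrite pnatr_eq0 -lt0n.
transitivity (\sum_(x <- s) S20_dot x x).
  rewrite -sum1_size natr_sum big_seq [RHS]big_seq; apply: eq_bigr => x xs.
  by case: os => _ ->; rewrite // eqxx.
rewrite (trace_S20 n0 os bs (ip_scalarl dip) (ip_scalarr dip)).
under eq_bigr => a _.
  under eq_bigr => b _ do rewrite !S20_dot_tens (ipC gip b a).
  rewrite big_split -mulr_sumr onb_sum_diag /=.
  over.
rewrite big_split -mulr_suml onb_sum_diag onb_sum_dot onb_sum_diag /=.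
under [X in _ - _ * X]eq_bigr => a _.
  under eq_bigr => b _ do rewrite !S20_dot_tens.
  over.
by rewrite onb_sum_dot onb_sum_diag; field.
Qed.

(** Independence of the trace from the basis: [trace_projection] with the identity as projection. It
    allows e to be replaced by its image under J or by a basis containing X and J X. *)
Lemma trace_onb (s : seq V) (Q : V -> V -> R) :
  (forall X, X = \sum_(y <- s) g X y *: y) ->
  (forall y, scalar (Q^~ y)) -> (forall x, scalar (Q x)) ->
  \sum_(x <- e) Q x x = \sum_(x <- s) Q x x.
Proof.
case: onbe => be _ ss Ql Qr.
exact: (trace_projection gip ose be (fun=> memvf _) (fun _ _ => erefl)
  (fun _ _ => erefl) ss Ql Qr).
Qed.

End Tensors.

(** * Tensors anticommuting with J *)

Section AntiInvariant.
Variables (R : realType) (V : vectType R) (g : {dot V for idfun}).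
Variables (J : 'End(V)) (n : nat) (e : n.-tuple V).
Hypothesis csJ : complex_structure g J.
Hypothesis onbe : onb g e.

Let gip : inner_product g := dot_inner_product g.
Let gl := ip_scalarl gip.
Let gr := ip_scalarr gip.
Local Notation tens := (tens g e).
Local Notation components := (components g e).
Local Notation dotS := (@S20_dot R n).
Let dip : inner_product dotS := S20_dot_inner_product R n.
Let dl := ip_scalarl dip.
Let dr := ip_scalarr dip.

Lemma JJ X : J (J X) = - X. Proof. by case: csJ. Qed.

Lemma gJJ X Y : g (J X) (J Y) = g X Y. Proof. by case: csJ. Qed.

Lemma gJl X Y : g (J X) Y = - g X (J Y).
Proof. by rewrite -(gJJ X (J Y)) JJ (scalar_opp (gr _)) opprK. Qed.

Lemma gXJX X : g X (J X) = 0.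
Proof.
have := gJl X X; rewrite (ipC gip (J X)) => /eqP.
by rewrite -subr_eq0 opprK -mulr2n mulrn_eq0 => /eqP.
Qed.

Definition mxJ : 'M[R]_n := \matrix_(i, k) g (J (tnth e k)) (tnth e i).

Lemma tr_mxJ : mxJ^T = - mxJ.
Proof. by apply/matrixP => i j; rewrite !mxE gJl (ipC gip). Qed.

Lemma mxJ_components X : mxJ *m components X = components (J X).
Proof.
apply/matrixP => i j; rewrite !mxE.
have fl : scalar (fun X => g (J X) (tnth e i)).
  by move=> a u v; rewrite linearP; exact: gl.
by rewrite (scalar_expand onbe X fl); apply: eq_bigr => k _; rewrite !mxE mulrC.
Qed.

(** As the transpose of J is its inverse, a tensor commutes with J when this map fixes it and
    anticommutes with J when this map negates it. *)
Definition conjJ : 'End('M[R]_n) := linfun (mulmx mxJ \o mulmxr mxJ^T).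

Lemma conjJE A : conjJ A = mxJ *m (A *m mxJ^T).
Proof. by rewrite lfunE. Qed.

Lemma conjJ_tens X Y : conjJ (tens X Y) = tens (J X) (J Y).
Proof.
rewrite conjJE /tens -!mxJ_components trmx_mul.
by rewrite !mulmxA.
Qed.

Lemma conjJ_tr A : conjJ A^T = (conjJ A)^T.
Proof. by rewrite !conjJE !trmx_mul trmxK mulmxA. Qed.

Lemma conjJ_selfadj A B : S20_dot (conjJ A) B = S20_dot A (conjJ B).
Proof.
rewrite /S20_dot !conjJE !trmx_mul trmxK -!mulmxA mxtrace_mulC tr_mxJ.
by rewrite !mulNmx !mulmxN !mulmxA !mulNmx.
Qed.

(** By linearity it suffices to check the frame, where the claim is invariance of g under J. *)
Lemma mxtrace_conjJ A : \tr (conjJ A) = \tr A.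
Proof.
have fl : scalar (fun B : 'M[R]_n => \tr (conjJ B) - \tr B).
  by move=> a B C; rewrite !linearP /=; ring.
apply/eqP; rewrite -subr_eq0; apply/eqP.
have := scalar_comb fl (tens_frame g e) (S20_dot A) id.
rewrite -(tens_frame_expand onbe A) => ->; rewrite big_allpairs_dep /=.
apply: big1 => a _; apply: big1 => b _.
by rewrite conjJ_tens !(mxtrace_tens onbe) gJJ subrr mulr0.
Qed.

(** The product of the projections (1 + transpose)/2 and (1 - [conjJ])/2, which commute by
    [conjJ_tr]. *)
Definition anti_proj : 'End('M[R]_n) :=
  (4^-1 *: (\1 + linfun trmx - (conjJ + (linfun trmx \o conjJ))))%VF.

Lemma anti_projE A :
  anti_proj A = 4^-1 *: (A + A^T - (conjJ A + (conjJ A)^T)).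
Proof.
by rewrite !(lfun_simp, lfunE) /=.
Qed.

(* The symmetric tensors that anticommute with J. *)
Definition antiV : {vspace 'M[R]_n} := fixedSpace anti_proj.

(** Twice the projection of [tens X Y]. With this factor and a unit vector X, the map [anti X] is an
    isometry on the orthogonal complement of X and J X. *)
Definition anti X Y : 'M[R]_n :=
  2^-1 *: (tens X Y + tens Y X - (tens (J X) (J Y) + tens (J Y) (J X))).

Lemma anti_proj_tens X Y : anti_proj (tens X Y) = 2^-1 *: anti X Y.
Proof.
rewrite anti_projE conjJ_tens !tr_tens /anti scalerA; congr (_ *: _).
by rewrite -invfM -natrM.
Qed.

Lemma antiC X Y : anti Y X = anti X Y.
Proof. by rewrite /anti (addrC (tens Y X)) (addrC (tens (J Y) _)). Qed.

Lemma antiJJ X Y : anti (J X) (J Y) = - anti X Y.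
Proof.
by rewrite /anti !JJ !tensNl !tensNr !opprK -scalerN opprB.
Qed.

Lemma anti_proj_anti X Y : anti_proj (anti X Y) = anti X Y.
Proof.
rewrite {1}/anti linearZ linearB !linearD /= !anti_proj_tens !antiJJ.
rewrite !(antiC X Y) !scalerN !opprK -!scalerDl scalerA -[RHS]scale1r.
by congr (_ *: _); field.
Qed.

Lemma anti_mem X Y : anti X Y \in antiV.
Proof. by apply/fixedSpaceP; exact: anti_proj_anti. Qed.

Lemma anti_proj_mem A : anti_proj A \in antiV.
Proof.
rewrite (tens_frame_expand onbe A) linear_sum big_allpairs_dep /=.
apply: memv_suml => a _; apply: memv_suml => b _.
by rewrite linearZ /= anti_proj_tens; apply/memvZ/memvZ/anti_mem.
Qed.

Lemma anti_proj_id A : A \in antiV -> anti_proj A = A.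
Proof. by move/fixedSpaceP. Qed.

Lemma anti_proj_selfadj A B :
  S20_dot (anti_proj A) B = S20_dot A (anti_proj B).
Proof.
rewrite !anti_projE (scalar_scale (dl _)) (scalar_scale (dr _)).
congr (_ * _); rewrite !(scalar_add (dl _), scalar_opp (dl _)).
rewrite !(scalar_add (dr _), scalar_opp (dr _)).
by rewrite !S20_dot_tr !conjJ_selfadj conjJ_tr.
Qed.

Lemma antiV_S20 : (antiV <= S20 R n)%VS.
Proof.
apply/subvP => A /anti_proj_id AE; apply/mem_S20; split.
  rewrite -AE anti_projE; apply/matrixP => i j; rewrite !mxE; ring.
rewrite -AE anti_projE linearZ linearB !linearD /= !mxtrace_tr mxtrace_conjJ.
by rewrite subrr mulr0.
Qed.

Lemma trace_antiV (s : seq 'M[R]_n) (Q : 'M[R]_n -> 'M[R]_n -> R) :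
  orthonormal_seq dotS s -> basis_of antiV s ->
  (forall y, scalar (Q^~ y)) -> (forall x, scalar (Q x)) ->
  \sum_(x <- s) Q x x =
  2^-1 * \sum_(a <- e) \sum_(b <- e) Q (tens a b) (anti a b).
Proof.
move=> os bs Ql Qr.
rewrite (trace_projection dip os bs anti_proj_mem anti_proj_id
  anti_proj_selfadj (tens_frame_expand onbe) Ql Qr).
rewrite big_allpairs_dep !mulr_sumr; apply: eq_bigr => a _.
rewrite !mulr_sumr; apply: eq_bigr => b _.
by rewrite anti_proj_tens (scalar_scale (Qr _)).
Qed.

Lemma S20_dot_tens_anti X Y Z W : S20_dot (tens X Y) (anti Z W) =
  2^-1 * (g X Z * g Y W + g X W * g Y Z
          - (g X (J Z) * g Y (J W) + g X (J W) * g Y (J Z))).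
Proof.
rewrite (scalar_scale (dr _)); congr (_ * _).
rewrite (scalar_add (dr _)) (scalar_opp (dr _)) !(scalar_add (dr _)).
by rewrite !(S20_dot_tens onbe).
Qed.

Lemma S20_dot_anti X Y Z W : S20_dot (anti X Y) (anti Z W) =
  g X Z * g Y W + g X W * g Y Z
  - (g X (J Z) * g Y (J W) + g X (J W) * g Y (J Z)).
Proof.
have -> : anti X Y = 2 *: anti_proj (tens X Y).
  by rewrite anti_proj_tens scalerA divff ?pnatr_eq0 // scale1r.
rewrite (scalar_scale (dl _)) anti_proj_selfadj anti_proj_anti.
by rewrite S20_dot_tens_anti mulrA divff ?pnatr_eq0 // mul1r.
Qed.

Lemma S20_dot_anti_unit X Y W : g X X = 1 ->
  S20_dot (anti X Y) (anti X W) =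
  g Y W + g X Y * g X W + g X (J Y) * g X (J W).
Proof.
move=> X1; rewrite S20_dot_anti X1 gXJX (ipC gip Y X) (ipC gip Y (J X)) gJl.
by ring.
Qed.

Lemma parseval X : \sum_(b <- e) g X b ^+ 2 = g X X.
Proof.
rewrite [RHS](scalar_expand onbe X (gl X)) big_tuple.
by apply: eq_bigr => i _; rewrite (ipC gip _ X).
Qed.

(** The dimension is again the trace of the inner product; for n = 2m it equals m(m+1). *)
Lemma size_antiV (s : seq 'M[R]_n) :
  orthonormal_seq dotS s -> basis_of antiV s ->
  (size s)%:R = (n%:R ^+ 2 + 2 * n%:R) / 4 :> R.
Proof.
move=> os bs.
transitivity (\sum_(x <- s) S20_dot x x).
  rewrite -sum1_size natr_sum big_seq [RHS]big_seq; apply: eq_bigr => x xs.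
  by case: os => _ ->; rewrite // eqxx.
rewrite (trace_antiV os bs dl dr).
under eq_bigr => a _.
  under eq_bigr => b _.
    rewrite S20_dot_tens_anti gXJX mul0r add0r (ipC gip b a).
    rewrite (ipC gip b (J a)) gJl mulrN opprK -!expr2.
    rewrite -(sqrrN (g a (J b))) -gJl.
    over.
  rewrite -mulr_sumr !big_split /= -mulr_sumr (onb_sum_diag onbe) !parseval gJJ.
  over.
by rewrite -mulr_sumr !big_split /= -mulr_suml !(onb_sum_diag onbe); field.
Qed.

End AntiInvariant.

Lemma natr_S20_dim (R : realType) (n : nat) : (0 < n)%N ->
  (S20_dim n)%:R = (n%:R ^+ 2 + n%:R - 2) / 2 :> R.
Proof.
case: n => // n _.
(* The two factors differ by 3, so one of them is even and the division by 2 is exact. *)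
have /divnK : (2 %| (n.+1 - 1) * (n.+1 + 2))%N.
  by rewrite dvdn2 oddM subn1 oddD /= addbF andbN.
rewrite -/(S20_dim _) => /(congr1 (fun k => k%:R : R)).
rewrite subn1 /= !natrM natrD -(natr1 n) => H; lra.
Qed.

(** * Traces of the curvature operator of the second kind in the Kaehler case *)

Section KahlerCurvature.
Variables (R : realType) (V : vectType R) (g : {dot V for idfun}).
Variables (J : 'End(V)) (n : nat) (e : n.-tuple V).
Variable (Rm : V -> V -> V -> V -> R).
Hypothesis csJ : complex_structure g J.
Hypothesis onbe : onb g e.
Hypothesis kR : kahler_curvature J Rm.

Let gip : inner_product g := dot_inner_product g.
Let JJ X : J (J X) = - X. Proof. by case: csJ. Qed.
Let fl : four_linear Rm. Proof. by case: kR => -[]. Qed.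
Let l1 Y Z W : scalar (fun X => Rm X Y Z W). Proof. by case: fl. Qed.
Let l2 X Z W : scalar (fun Y => Rm X Y Z W). Proof. by case: fl. Qed.
Let l3 X Y W : scalar (fun Z => Rm X Y Z W). Proof. by case: fl. Qed.
Let l4 X Y Z : scalar (fun W => Rm X Y Z W). Proof. by case: fl. Qed.
Local Notation tens := (tens g e).
Local Notation anti := (anti g J e).
Local Notation Q := (second_kind e Rm).
Local Notation dotS := (@S20_dot R n).
Let Ql := second_kind_scalarl e Rm.
Let Qr := second_kind_scalarr e Rm.

Lemma curv12 X Y Z W : Rm X Y Z W = - Rm Y X Z W.
Proof. by case: kR => -[]. Qed.

Lemma curv34 X Y Z W : Rm X Y Z W = - Rm X Y W Z.
Proof. by case: kR => -[]. Qed.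

Lemma curv_sym X Y Z W : Rm X Y Z W = Rm Z W X Y.
Proof. by case: kR => -[]. Qed.

Lemma curv_bianchi X Y Z W : Rm X Y Z W + Rm Y Z X W + Rm Z X Y W = 0.
Proof. by case: kR => -[]. Qed.

Lemma curvJ34 X Y Z W : Rm X Y (J Z) (J W) = Rm X Y Z W.
Proof. by case: kR => _ h; rewrite -h. Qed.

Lemma curvJ12 X Y Z W : Rm (J X) (J Y) Z W = Rm X Y Z W.
Proof. by rewrite curv_sym curvJ34 curv_sym. Qed.

Lemma curv_diag12 X Z W : Rm X X Z W = 0.
Proof.
have /eqP := curv12 X X Z W.
by rewrite -subr_eq0 opprK -mulr2n mulrn_eq0 => /eqP.
Qed.

Definition bisect X Y : R := Rm X (J X) Y (J Y).

Lemma bisectC X Y : bisect X Y = bisect Y X.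
Proof. exact: curv_sym. Qed.

Lemma bisectJr X Y : bisect X (J Y) = bisect X Y.
Proof. exact: curvJ34. Qed.

(** The first Bianchi identity for X, J X, Y, J Y, with J moved across by invariance. *)
Lemma bisectE X Y : bisect X Y = Rm X Y X Y + Rm X (J Y) X (J Y).
Proof.
have := curv_bianchi X (J X) Y (J Y); rewrite -/(bisect X Y).
rewrite (curv12 Y X) curvJ34 (curv34 _ _ _ Y) -(curvJ12 (J X) Y) JJ.
rewrite (scalar_opp (l1 _ _ _)) => H; lra.
Qed.

(** Of the four terms one vanishes, one is half of [bisect X Y], and the remaining two make up the
    other half by [bisectE]. *)
Lemma second_kind_tens_anti X Y : Q (tens X Y) (anti X Y) = bisect X Y.
Proof.
rewrite (scalar_scale (Qr _)) (scalar_add (Qr _)) (scalar_opp (Qr _)).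
rewrite !(scalar_add (Qr _)) !(second_kind_tens onbe _ _ _ _ fl).
rewrite curv_diag12 (curv34 X (J X)) -/(bisect X Y).
rewrite -(curvJ34 X (J Y) (J X)) JJ (scalar_opp (l3 _ _ _)).
have := bisectE X Y => H; lra.
Qed.

(** By [antiC] and [antiJJ] the right argument can be matched, up to sign, with each of the four
    tensors on the left; each then contributes half of [bisect X Y]. *)
Lemma second_kind_anti X Y : Q (anti X Y) (anti X Y) = 2 * bisect X Y.
Proof.
rewrite {1}/anti (scalar_scale (Ql _)) (scalar_add (Ql _)) (scalar_opp (Ql _)).
rewrite !(scalar_add (Ql _)) second_kind_tens_anti.
rewrite -{1}(antiC g J e X Y) second_kind_tens_anti (bisectC Y X).
have antiN : anti X Y = - anti (J X) (J Y) by rewrite (antiJJ _ csJ) opprK.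
rewrite {1}antiN (scalar_opp (Qr _)) second_kind_tens_anti.
rewrite antiN -(antiC g J e (J X)) (scalar_opp (Qr _)) second_kind_tens_anti.
rewrite (bisectC (J Y)) bisectJr (bisectC (J X)) bisectJr (bisectC Y X).
by field.
Qed.

Lemma onb_expandJ X : X = \sum_(y <- [seq J x | x <- e]) g X y *: y.
Proof.
rewrite big_map -[LHS]opprK -JJ {1}(onb_expand onbe (J (- X))) linear_sum.
apply: eq_bigr => y _; rewrite linearZ /=; congr (_ *: _).
by rewrite (gJl csJ) (scalar_opp (ip_scalarl gip _)) opprK.
Qed.

(** By [bisectE] the sum splits into two Ricci sums, one over e and one over its image under J, and
    these agree since the trace does not depend on the basis. *)
Lemma sum_bisect X : \sum_(b <- e) bisect X b = 2 * Ric e Rm X X.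
Proof.
under eq_bigr => b _ do rewrite bisectE.
rewrite big_split /= mulr_natl mulr2n; congr (_ + _).
  by rewrite big_tuple.
transitivity (\sum_(y <- [seq J x | x <- e]) Rm X y X y).
  by rewrite big_map.
rewrite -(trace_onb onbe (Q := fun y z => Rm X y X z) onb_expandJ) ?big_tuple //.
Qed.

Definition scal : R := \sum_(a <- e) Ric e Rm a a.

Lemma trace_second_kind_antiV (s : seq 'M[R]_n) :
  orthonormal_seq dotS s -> basis_of (antiV g J e) s ->
  \sum_(x <- s) Q x x = scal.
Proof.
move=> os bs; rewrite (trace_antiV csJ onbe os bs Ql Qr) /scal mulr_sumr.
apply: eq_bigr => a _; under eq_bigr => b _ do rewrite second_kind_tens_anti.
by rewrite sum_bisect mulrA mulVf ?pnatr_eq0 // mul1r.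
Qed.

(** The two double sums of [trace_S20] are [scal] and -[scal]. Subtracting the trace over [antiV]
    leaves -(1/2 - 1/n) [scal] for the J-invariant part. *)
Lemma trace_second_kind_S20 (s : seq 'M[R]_n) : (0 < n)%N ->
  orthonormal_seq dotS s -> basis_of (S20 R n) s ->
  \sum_(x <- s) Q x x = (2^-1 + n%:R^-1) * scal.
Proof.
move=> n0 os bs; rewrite (trace_S20 onbe n0 os bs Ql Qr) mulrDl /scal.
rewrite -[X in _ - X]opprK opprK -mulrN -sumrN; congr (_ * _ + _ * _).
  apply: eq_bigr => a _; rewrite /Ric big_tuple; apply: eq_bigr => i _.
  by rewrite !(second_kind_tens onbe _ _ _ _ fl) curv_diag12 add0r.
apply: eq_bigr => a _; rewrite /Ric big_tuple -sumrN; apply: eq_bigr => i _.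
by rewrite !(second_kind_tens onbe _ _ _ _ fl) -curv34.
Qed.

(** The weights are t on psi, s on the rest of [antiV] and r on its complement in S^2_0, whose
    dimension is (n^2 - 4)/4. *)
Lemma second_kind_weighted (psi : seq 'M[R]_n) (r s t alpha : R) :
  (0 < n)%N -> orthonormal_seq dotS psi -> {subset psi <= antiV g J e} ->
  0 <= r <= 1 -> 0 <= s <= 1 -> 0 <= t <= 1 ->
  alpha = t * (size psi)%:R + s * ((n%:R ^+ 2 + 2 * n%:R) / 4 - (size psi)%:R)
          + r * ((n%:R ^+ 2 - 4) / 4) ->
  alpha < (n%:R ^+ 2 + n%:R - 2) / 2 ->
  exists phi, S20_onb phi /\
    alpha_sum e Rm alpha phi <=
    t * \sum_(x <- psi) Q x x + s * (scal - \sum_(x <- psi) Q x x)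
    - r * ((2^-1 - n%:R^-1) * scal).
Proof.
move=> n0 op psiV hr hs ht ha altN.
have dip := S20_dot_inner_product R n.
(* A nested extension: psi is completed by q to a basis of [antiV], then by w to a basis of
   S^2_0. *)
have [q [oq bq]] := orthonormal_extend dip op psiV.
have qV : {subset psi ++ q <= S20 R n}.
  by move=> x xq; apply: (subvP (antiV_S20 csJ onbe)); exact: basis_mem bq xq.
have [w [ow bw]] := orthonormal_extend dip oq qV.
have szA := size_antiV csJ onbe oq bq.
have szS := size_S20 onbe n0 ow bw.
have trA := trace_second_kind_antiV oq bq.
have trS := trace_second_kind_S20 n0 ow bw.
pose L := [seq (x, t) | x <- psi] ++ [seq (x, s) | x <- q]
  ++ [seq (x, r) | x <- w].
have L1 : unzip1 L = (psi ++ q) ++ w.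
  by rewrite /unzip1 !map_cat -!map_comp !map_id catA.
have sL : size L = S20_dim n.
  rewrite -(size_map fst) -/(unzip1 L) L1 -(natr_S20_dim R n0) in szS *.
  by apply/eqP; rewrite -(eqr_nat R) szS.
rewrite !size_cat !natrD in szA szS; rewrite !big_cat /= in trA trS.
have [] := @alpha_sum_le_weighted R V n e Rm alpha L.
- by rewrite L1.
- by rewrite L1.
- exact: sL.
- by move=> p; rewrite !mem_cat => /or3P[] /mapP[x _ ->].
- rewrite !big_cat !big_map /= !big_const_seq !count_predT !iter_addr_0.
  rewrite -(mulr_natr t) -(mulr_natr s) -(mulr_natr r) ha -szA.
  have -> : (n%:R ^+ 2 - 4) / 4 = (size w)%:R :> R by lra.
  by ring.
- by rewrite natr_S20_dim.
move=> phi [ophi le_phi]; exists phi; split=> //.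
apply: le_trans le_phi _; rewrite !big_cat !big_map /= -!mulr_sumr.
have -> : \sum_(x <- q) Q x x = scal - \sum_(x <- psi) Q x x by lra.
have -> : \sum_(x <- w) Q x x = - ((2^-1 - n%:R^-1) * scal) by lra.
by rewrite mulrN addrA.
Qed.

End KahlerCurvature.

(** * Quantities controlled by an alpha-sum *)

Lemma unit_vector (R : realType) (V : vectType R) (g : {dot V for idfun})
    (X : V) : X != 0 -> exists k x, [/\ 0 < k, g x x = 1 & X = k *: x].
Proof.
have gip := dot_inner_product g; move=> X0; have gX := ip_gt0 gip X0.
have k0 : 0 < Num.sqrt (g X X) by rewrite sqrtr_gt0.
exists (Num.sqrt (g X X)), ((Num.sqrt (g X X))^-1 *: X); split=> //.
  rewrite (scalar_scale (ip_scalarl gip _)) (scalar_scale (ip_scalarr gip _)).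
  by rewrite mulrA -expr2 exprVn sqr_sqrtr ?ltW // mulVf // gt_eqF.
by rewrite scalerA divff ?gt_eqF // scale1r.
Qed.

(** A single basis with alpha-sum at most a positive multiple of x makes x inherit both
    nonnegativity and positivity. Leaving c free makes the notion invariant under positive rescaling
    of x. *)
Definition alpha_controls (R : realType) (V : vectType R) (n : nat)
    (e : n.-tuple V) (Rm : V -> V -> V -> V -> R) (alpha x : R) : Prop :=
  exists phi, S20_onb phi /\ exists2 c, 0 < c & alpha_sum e Rm alpha phi <= c * x.

Section AlphaControls.
Variables (R : realType) (V : vectType R) (n : nat) (e : n.-tuple V).
Variables (Rm : V -> V -> V -> V -> R) (alpha : R).

Lemma alpha_controls_ge0 x : alpha_controls e Rm alpha x ->
  alpha_nonnegative e alpha Rm -> 0 <= x.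
Proof.
move=> [phi [ophi [c c0 le_x]]] /(_ _ ophi) ge0.
by rewrite -(pmulr_rge0 _ c0) (le_trans ge0).
Qed.

Lemma alpha_controls_gt0 x : alpha_controls e Rm alpha x ->
  alpha_positive e alpha Rm -> 0 < x.
Proof.
move=> [phi [ophi [c c0 le_x]]] /(_ _ ophi) gt0.
by rewrite -(pmulr_rgt0 _ c0) (lt_le_trans gt0).
Qed.

Lemma alpha_controls_scale k x : 0 < k -> alpha_controls e Rm alpha x ->
  alpha_controls e Rm alpha (k * x).
Proof.
move=> k0 [phi [ophi [c c0 le_x]]]; exists phi; split=> //.
exists (c / k); first by rewrite divr_gt0.
by rewrite mulrA divfK // gt_eqF.
Qed.

End AlphaControls.

(** * Families of anti-invariant tensors and the resulting bounds *)

Section Bounds.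
Variables (R : realType) (m : nat) (V : vectType R) (g : {dot V for idfun}).
Variables (J : 'End(V)) (e : (2 * m).-tuple V).
Variable (Rm : V -> V -> V -> V -> R).
Hypothesis m2 : (2 <= m)%N.
Hypothesis csJ : complex_structure g J.
Hypothesis onbe : onb g e.
Hypothesis kR : kahler_curvature J Rm.

Let gip : inner_product g := dot_inner_product g.
Let gl := ip_scalarl gip.
Let gr := ip_scalarr gip.
Let dip := S20_dot_inner_product R (2 * m).
Let fl : four_linear Rm. Proof. by case: kR => -[]. Qed.
Let l1 Y Z W : scalar (fun X => Rm X Y Z W). Proof. by case: fl. Qed.
Let l2 X Z W : scalar (fun Y => Rm X Y Z W). Proof. by case: fl. Qed.
Let l3 X Y W : scalar (fun Z => Rm X Y Z W). Proof. by case: fl. Qed.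
Let l4 X Y Z : scalar (fun W => Rm X Y Z W). Proof. by case: fl. Qed.
Local Notation anti := (anti g J e).
Local Notation antiV := (antiV g J e).
Local Notation Q := (second_kind e Rm).
Local Notation dotS := (@S20_dot R (2 * m)).
Local Notation bis := (bisect J Rm).
Local Notation mr := (m%:R : R).

Let mr2 : 2 <= mr. Proof. by rewrite ler_nat. Qed.

Let mr_neq0 : mr != 0. Proof. by rewrite pnatr_eq0 -lt0n (ltnW m2). Qed.

Let n0 : (0 < 2 * m)%N. Proof. by lia. Qed.

(* Weight 1 on the invariant tensors and (m - 1) / (2 m) on the anti-invariant
   ones annihilates every Kaehler curvature operator; raising the weights of
   psi to 1 therefore isolates the trace over psi. *)
Lemma alpha_controls_family (psi : seq 'M[R]_(2 * m)) (x alpha : R) :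
  orthonormal_seq dotS psi -> {subset psi <= antiV} -> (size psi <= 2 * m)%N ->
  alpha = 3 / 2 * (mr ^+ 2 - 1) + (size psi)%:R * ((mr + 1) / (2 * mr)) ->
  \sum_(y <- psi) Q y y = 2 * x ->
  alpha_controls e Rm alpha x.
Proof.
move=> op pV sp ha tr.
have mr_ge2 := mr2; have mr0 := mr_neq0.
have nE : (2 * m)%:R = 2 * mr :> R by rewrite natrM.
have spr : (size psi)%:R <= 2 * mr by rewrite -nE ler_nat.
have d0 : 0 <= (mr + 1) / (2 * mr) by apply: divr_ge0; lra.
have [|||||phi [ophi le_phi]] := @second_kind_weighted R V g J _ e Rm csJ onbe
  kR psi 1 ((mr - 1) / (2 * mr)) 1 alpha n0 op pV.
- by rewrite ler01 lexx.
- apply/andP; split; first by apply: divr_ge0; lra.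
  by rewrite ler_pdivrMr; lra.
- by rewrite ler01 lexx.
- by rewrite ha nE; field.
- rewrite nE ha.
  (* The mass is largest for 2m tensors, where it is 3/2 (m^2 - 1) + m + 1, still below dim S^2_0 =
     2m^2 + m - 1. *)
  apply: (@le_lt_trans _ _ (3 / 2 * (mr ^+ 2 - 1) + 2 * mr * ((mr + 1) / (2 * mr)))).
    by rewrite lerD2l ler_wpM2r.
  have -> : 2 * mr * ((mr + 1) / (2 * mr)) = mr + 1 by field.
  by nra.
(* Since (m-1)/(2m) = 1/2 - 1/(2m), the scalar curvature cancels, and (1 - (m-1)/(2m)) 2x =
   ((m+1)/m) x remains. *)
exists phi; split=> //; exists ((mr + 1) / mr); first by apply: divr_gt0; lra.
apply: le_trans le_phi _; rewrite tr nE le_eqVlt; apply/orP; left.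
by apply/eqP; field.
Qed.

Lemma size_full_onb (s : seq V) : basis_of fullv s -> size s = (2 * m)%N.
Proof.
case: onbe => be _ bs.
by rewrite -(size_basis (X := in_tuple s) bs) (size_basis be).
Qed.

(** Normalising factor: for a unit X both [anti X X] and [anti X (J X)] have squared norm 2. *)
Let c2 : R := (Num.sqrt 2)^-1.
Let c2E : c2 * c2 = 2^-1.
Proof. by rewrite -expr2 exprVn sqr_sqrtr // ler0n. Qed.

Definition diag_family X := [:: c2 *: anti X X; c2 *: anti X (J X)].

Lemma diag_family_onb X : g X X = 1 -> orthonormal_seq dotS (diag_family X).
Proof.
move=> X1.
have dE Y Z : S20_dot (c2 *: anti X Y) (c2 *: anti X Z) =
    2^-1 * (g Y Z + g X Y * g X Z + g X (J Y) * g X (J Z)).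
  rewrite (scalar_scale (ip_scalarl dip _)) (scalar_scale (ip_scalarr dip _)).
  by rewrite mulrA c2E (S20_dot_anti_unit csJ onbe).
apply: (orthonormal_seq2 dip); rewrite dE ?(JJ csJ) ?(gJJ csJ) ?(scalar_opp (gr _)).
- by rewrite X1 (gXJX csJ); field.
- by rewrite X1 (gXJX csJ); field.
- by rewrite X1 (gXJX csJ); field.
Qed.

Lemma diag_family_sub X : {subset diag_family X <= antiV}.
Proof.
by move=> x; rewrite !inE => /orP[] /eqP ->; apply/memvZ/(anti_mem csJ).
Qed.

Lemma second_kind_scaled_anti X Y :
  Q (c2 *: anti X Y) (c2 *: anti X Y) = bis X Y.
Proof.
rewrite (scalar_scale (second_kind_scalarl e Rm _)).
rewrite (scalar_scale (second_kind_scalarr e Rm _)) mulrA c2E.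
by rewrite (second_kind_anti csJ onbe kR) mulrA mulVf ?pnatr_eq0 // mul1r.
Qed.

Lemma diag_family_sum X : \sum_(y <- diag_family X) Q y y = 2 * bis X X.
Proof.
rewrite big_cons big_seq1 !second_kind_scaled_anti (bisectJr kR).
by rewrite mulr_natl mulr2n.
Qed.

Lemma unitary_completion X : g X X = 1 -> exists f : seq V,
  orthonormal_seq g ([:: X; J X] ++ f) /\ basis_of fullv ([:: X; J X] ++ f).
Proof.
move=> X1; apply: (orthonormal_extend gip) => [|x _]; last exact: memvf.
by apply: (orthonormal_seq2 gip); rewrite ?(gJJ csJ) ?(gXJX csJ).
Qed.

Section OrthogonalFamily.
Variables (X : V) (f : seq V).
Hypothesis X1 : g X X = 1.
Hypothesis of_ : orthonormal_seq g ([:: X; J X] ++ f).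
Hypothesis bf : basis_of fullv ([:: X; J X] ++ f).

Let gXf y : y \in f -> g X y = 0.
Proof. by move=> yf; apply: (orthonormal_seq_cat0 of_ _ yf); rewrite mem_head. Qed.

Let gXJf y : y \in f -> g X (J y) = 0.
Proof.
move=> yf; apply/eqP; rewrite -oppr_eq0 -(gJl csJ); apply/eqP.
by apply: (orthonormal_seq_cat0 of_ _ yf); rewrite !inE eqxx orbT.
Qed.

Lemma orth_family_onb : orthonormal_seq dotS (map (anti X) f).
Proof.
apply: orthonormal_seq_map (orthonormal_seq_catr of_) => y z yf zf.
by rewrite (S20_dot_anti_unit csJ onbe) // (gXf yf) (gXJf yf) !mul0r !addr0.
Qed.

Lemma orth_family_sub : {subset map (anti X) f <= antiV}.
Proof. by move=> _ /mapP[y _ ->]; exact: (anti_mem csJ). Qed.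

Lemma orth_family_size : size (map (anti X) f) = (2 * m - 2)%N.
Proof. by have := size_full_onb bf; rewrite size_map /= => <-; lia. Qed.

(** In the basis X, J X, f the sum of [bis X] is 2 Ric(X,X) by [sum_bisect]; X and J X account for
    [bis X X] each, and f for the rest. *)
Lemma orth_family_sum :
  \sum_(y <- map (anti X) f) Q y y = 2 * (2 * (Ric e Rm X X - bis X X)).
Proof.
rewrite big_map.
under eq_bigr => y _ do rewrite (second_kind_anti csJ onbe kR).
rewrite -mulr_sumr; congr (_ * _).
have expand Y : Y = \sum_(y <- [:: X; J X] ++ f) g Y y *: y.
  exact: (basis_orthonormal_expand gip of_ bf (memvf Y)).
have qr Y : scalar (fun Z => Rm X (J X) Y (J Z)).
  by move=> a u v; rewrite linearP; exact: l4.
have := sum_bisect csJ onbe kR X.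
rewrite (trace_onb onbe (Q := fun y z => Rm X (J X) y (J z)) expand) //.
rewrite !big_cons -!/(bis _ _) (bisectJr kR) => H; lra.
Qed.

(** For z in f the product of [anti X Y] and [anti X z] is g Y z, which vanishes for Y = X and Y = J
    X. *)
Lemma diag_orth_onb :
  orthonormal_seq dotS (diag_family X ++ map (anti X) f).
Proof.
apply: (orthonormal_seq_cat dip (diag_family_onb X1) orth_family_onb).
have dE Y z : z \in f -> S20_dot (c2 *: anti X Y) (anti X z) = c2 * g Y z.
  move=> zf; rewrite (scalar_scale (ip_scalarl dip _)).
  by rewrite (S20_dot_anti_unit csJ onbe) // (gXf zf) (gXJf zf) !mulr0 !addr0.
move=> x _ + /mapP[z zf ->]; rewrite !inE => /orP[] /eqP ->; rewrite dE //.
  by rewrite (gXf zf) mulr0.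
by rewrite (gJl csJ) (gXJf zf) oppr0 mulr0.
Qed.

End OrthogonalFamily.

Lemma bisect_scale k l X Y : bis (k *: X) (l *: Y) = (k * l) ^+ 2 * bis X Y.
Proof.
rewrite /bisect !linearZ /= (scalar_scale (l1 _ _ _)) (scalar_scale (l2 _ _ _)).
by rewrite (scalar_scale (l3 _ _ _)) (scalar_scale (l4 _ _ _)); ring.
Qed.

Lemma Ric_scale k X : Ric e Rm (k *: X) (k *: X) = k ^+ 2 * Ric e Rm X X.
Proof.
rewrite /Ric mulr_sumr; apply: eq_bigr => a _.
by rewrite (scalar_scale (l1 _ _ _)) (scalar_scale (l3 _ _ _)); ring.
Qed.

Lemma dot_scale k X : g (k *: X) (k *: X) = k ^+ 2 * g X X.
Proof. by rewrite (scalar_scale (gl _)) (scalar_scale (gr _)) mulrA. Qed.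

Lemma alpha_controls_hol X : X != 0 ->
  alpha_controls e Rm (alpha_m R m) (Rm X (J X) X (J X)).
Proof.
move=> /(unit_vector g)[k [x [k0 x1 ->]]]; rewrite -/(bis _ _) bisect_scale.
apply: alpha_controls_scale; first by rewrite exprn_gt0 // mulr_gt0.
apply: (alpha_controls_family (diag_family_onb x1) (@diag_family_sub x)).
- by rewrite /=; lia.
- by rewrite /alpha_m /=; field; exact: mr_neq0.
- exact: diag_family_sum.
Qed.

Lemma alpha_controls_orth_bisect X Y : X != 0 -> Y != 0 -> g X Y = 0 ->
  g X (J Y) = 0 -> alpha_controls e Rm (alpha_m R m) (Rm X (J X) Y (J Y)).
Proof.
move=> /(unit_vector g)[k [x [k0 x1 ->]]] /(unit_vector g)[l [y [l0 y1 ->]]].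
have JZ a Z : J (a *: Z) = a *: J Z by rewrite linearZ.
rewrite [in g _ (J _)]JZ !(scalar_scale (gl _)) !(scalar_scale (gr _)) !mulrA.
have kl0 : k * l != 0 by rewrite mulf_neq0 // gt_eqF.
move=> /eqP; rewrite mulf_eq0 (negPf kl0) => /eqP xy.
move=> /eqP; rewrite mulf_eq0 (negPf kl0) => /eqP xJy.
rewrite -/(bis _ _) bisect_scale.
apply: alpha_controls_scale; first by rewrite exprn_gt0 // mulr_gt0.
(* Each of the two tensors contributes 2 [bis x y], so the family controls 2 [bis x y], which is
   then halved. *)
suff: alpha_controls e Rm (alpha_m R m) (2 * bis x y).
  move=> /(@alpha_controls_scale _ _ _ _ _ _ 2^-1); rewrite mulrA mulVf ?pnatr_eq0 //.
  by rewrite mul1r; apply; rewrite invr_gt0.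
apply: (@alpha_controls_family [:: anti x y; anti x (J y)]).
- apply: (orthonormal_seq2 dip); rewrite (S20_dot_anti_unit csJ onbe) //.
  + by rewrite y1 xy xJy; ring.
  + by rewrite (gJJ csJ) y1 xJy (JJ csJ) (scalar_opp (gr _)) xy; ring.
  + by rewrite (gXJX csJ) xy xJy; ring.
- by move=> z; rewrite !inE => /orP[] /eqP ->; exact: (anti_mem csJ).
- by rewrite /=; lia.
- by rewrite /alpha_m /=; field; exact: mr_neq0.
- rewrite big_cons big_seq1 !(second_kind_anti csJ onbe kR) (bisectJr kR).
  by ring.
Qed.

Lemma alpha_controls_orth_ric X : X != 0 -> alpha_controls e Rm (beta_m R m)
  (Ric e Rm X X - Rm X (J X) X (J X) / g X X).
Proof.
move=> /(unit_vector g)[k [x [k0 x1 ->]]]; rewrite -/(bis _ _) bisect_scale.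
rewrite Ric_scale dot_scale x1.
(* The factor 2 is what [orth_family_sum] produces; it is compensated in the positive scaling
   k^2/2. *)
have -> : k ^+ 2 * Ric e Rm x x - (k * k) ^+ 2 * bis x x / (k ^+ 2 * 1) =
    (k ^+ 2 / 2) * (2 * (Ric e Rm x x - bis x x)).
  by field; rewrite gt_eqF.
apply: alpha_controls_scale; first by rewrite divr_gt0 // exprn_gt0.
have [f [of_ bf]] := unitary_completion x1.
apply: (alpha_controls_family (orth_family_onb x1 of_) (@orth_family_sub x f)).
- by rewrite (orth_family_size bf); lia.
- rewrite (orth_family_size bf) natrB ?natrM; last by lia.
  by rewrite /beta_m; field; exact: mr_neq0.
- exact: orth_family_sum.
Qed.

Lemma alpha_controls_mixed_ric X : X != 0 -> alpha_controls e Rm (gamma_m R m)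
  (2 * Ric e Rm X X - Rm X (J X) X (J X) / g X X).
Proof.
move=> /(unit_vector g)[k [x [k0 x1 ->]]]; rewrite -/(bis _ _) bisect_scale.
rewrite Ric_scale dot_scale x1.
have -> : 2 * (k ^+ 2 * Ric e Rm x x) - (k * k) ^+ 2 * bis x x / (k ^+ 2 * 1) =
    k ^+ 2 * (2 * Ric e Rm x x - bis x x).
  by field; rewrite gt_eqF.
apply: alpha_controls_scale; first by rewrite exprn_gt0.
have [f [of_ bf]] := unitary_completion x1.
apply: (alpha_controls_family (diag_orth_onb x1 of_)).
- move=> y; rewrite mem_cat => /orP[/diag_family_sub //|/orth_family_sub //].
- by rewrite size_cat (orth_family_size bf) /=; lia.
- rewrite size_cat (orth_family_size bf) natrD natrB ?natrM /=; last by lia.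
  by rewrite /gamma_m; field; exact: mr_neq0.
(* The total is 2 [bis x x] + 4 (Ric(x,x) - [bis x x]) = 2 (2 Ric(x,x) - [bis x x]). *)
- by rewrite big_cat /= diag_family_sum (orth_family_sum of_ bf); ring.
Qed.

(* At the threshold 3/2 (m^2 - 1) the weighted sum vanishes identically, so
   shifting a little weight onto or away from a unit anti-invariant tensor
   forces its value to be the average. *)
Lemma const_hol_sect_of_nonnegative :
  alpha_nonnegative e (3 / 2 * (mr ^+ 2 - 1)) Rm ->
  exists2 c : R, 0 <= c & const_hol_sect_curv g J Rm c.
Proof.
move=> nn.
have mr_ge2 := mr2; have mr0 := mr_neq0.
have nE : (2 * m)%:R = 2 * mr :> R by rewrite natrM.
(* M is the dimension m(m+1) of [antiV]. *)
pose M := mr ^+ 2 + mr; have M6 : 6 <= M by rewrite /M; nra.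
have MN0 : M != 0 by rewrite gt_eqF //; lra.
pose s0 := (mr - 1) / (2 * mr).
have s0E : s0 = 2^-1 - (2 * mr)^-1 by rewrite /s0; field.
have i0 : 0 < (2 * mr)^-1 by rewrite invr_gt0; lra.
have i4 : (2 * mr)^-1 <= 4^-1 by rewrite lef_pV2 ?posrE; lra.
have altN : 3 / 2 * (mr ^+ 2 - 1) < ((2 * m)%:R ^+ 2 + (2 * m)%:R - 2) / 2.
  by rewrite nE; nra.
have S0 : 0 <= scal e Rm.
  (* The uniform weight alpha / dim S^2_0, for which the weighted sum is w times the full trace (1/2
     + 1/(2m)) [scal]. *)
  pose w := 3 * (mr - 1) / (2 * (2 * mr - 1)).
  have w0 : 0 < w by apply: divr_gt0; lra.
  have w1 : 0 <= w <= 1.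
    by rewrite ltW //= ler_pdivrMr; lra.
  have [||phi [ophi le_phi]] := @second_kind_weighted R V g J _ e Rm csJ onbe kR
    [::] w w w _ n0 (orthonormal_seq_nil _) _ w1 w1 w1 _ altN.
  - by [].
  - by rewrite nE /w /=; field; rewrite gt_eqF //; lra.
  have := le_trans (nn _ ophi) le_phi.
  rewrite big_nil mulr0 add0r subr0 -mulrBr nE pmulr_rge0 //.
  have -> : scal e Rm - (2^-1 - (2 * mr)^-1) * scal e Rm =
    (2^-1 + (2 * mr)^-1) * scal e Rm by field.
  by rewrite pmulr_rge0 //; lra.
(* The trace over [antiV] is [scal], so this constant is the average value there. *)
exists (scal e Rm / M); first by apply: divr_ge0 => //; lra.
move=> X X1; rewrite -/(bis X X).
(* One unit tensor gains (M - 1) eps while the M - 1 other anti-invariant directions lose eps each,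
   so the mass is unchanged. As s0 lies between 1/4 and 1/2, the bound on eps keeps all weights in
   [0, 1]. *)
have key eps : `|eps| <= (8 * M)^-1 -> 0 <= eps * (M * bis X X - scal e Rm).
  rewrite ler_norml => /andP[eps1 eps2].
  have M0 : 0 < M by lra.
  have ME : (8 * M)^-1 * M = 8^-1 by field.
  have Me1 : - 8^-1 <= eps * M by rewrite -ME -mulNr ler_pM2r.
  have Me2 : eps * M <= 8^-1 by rewrite -ME ler_pM2r.
  have e8 : (8 * M)^-1 <= 8^-1 by rewrite lef_pV2 ?posrE; lra.
  have [||||||phi [ophi le_phi]] := @second_kind_weighted R V g J _ e Rm csJ
    onbe kR [:: c2 *: anti X X] 1 (s0 - eps) (s0 + (M - 1) * eps) _ n0
    _ _ _ _ _ _ altN.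
  - apply: orthonormal_seq1; case: (diag_family_onb X1) => _ ->.
    + by rewrite eqxx.
    + exact: mem_head.
    + exact: mem_head.
  - by move=> y; rewrite inE => /eqP ->; apply/memvZ/(anti_mem csJ).
  - by rewrite ler01 lexx.
  - by rewrite s0E; apply/andP; split; lra.
  - by rewrite s0E; apply/andP; split; lra.
  - by rewrite nE /s0 /M /=; field.
  apply: le_trans (nn _ ophi) (le_trans le_phi _).
  rewrite big_seq1 second_kind_scaled_anti nE -s0E le_eqVlt; apply/orP; left.
  by apply/eqP; ring.
apply/(mulfI MN0); rewrite mulrCA divff // mulr1; apply/eqP.
rewrite -subr_eq0 eq_le; apply/andP.
(* Both signs of eps are admissible, so the factor multiplying eps vanishes. *)
have M8 : 0 < (8 * M)^-1 by rewrite invr_gt0; lra.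
have := key (8 * M)^-1; rewrite gtr0_norm // lexx pmulr_rge0 // => kp.
have := key (- (8 * M)^-1); rewrite normrN gtr0_norm // lexx mulNr oppr_ge0 pmulr_rle0 // => kn.
by split; [exact: kn | exact: kp].
Qed.

End Bounds.

(** * Passage to the opposite curvature and assembly of the four parts *)

Lemma kahler_opp_curvature (R : realType) (V : vectType R) (J : 'End(V))
    (Rm : V -> V -> V -> V -> R) :
  kahler_curvature J Rm -> kahler_curvature J (opp_curvature Rm).
Proof.
move=> [[[l1 l2 l3 l4] a12 a34 sym bia] kJ].
have sN (f : V -> R) : scalar f -> scalar (fun X => - f X).
  by move=> fl a u v; rewrite fl opprD mulrN.
split; last by move=> X Y Z W; rewrite /opp_curvature kJ.
split=> [|X Y Z W|X Y Z W|X Y Z W|X Y Z W]; rewrite /opp_curvature.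
- split=> *; apply: sN; [exact: l1|exact: l2|exact: l3|exact: l4].
- by rewrite a12.
- by rewrite a34.
- by rewrite sym.
- by rewrite -!opprD bia oppr0.
Qed.

Lemma Ric_opp_curvature (R : realType) (V : vectType R) (n : nat)
    (e : n.-tuple V) (Rm : V -> V -> V -> V -> R) (X Y : V) :
  Ric e (opp_curvature Rm) X Y = - Ric e Rm X Y.
Proof. exact: sumrN. Qed.

Unset Implicit Arguments.

Theorem theorem1p10 (R : realType) (m : nat) (V : vectType R)
    (g : {dot V for idfun}) (J : 'End(V)) (e : (2 * m).-tuple V)
    (Rm : V -> V -> V -> V -> R) :
  (2 <= m)%N ->
  \dim {:V} = (2 * m)%N ->
  complex_structure g J ->
  onb g e ->
  kahler_curvature J Rm ->
  [/\ (* (1) *)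
      (alpha_nonnegative e (3 / 2 * (m%:R ^+ 2 - 1)) Rm ->
         exists2 c : R, 0 <= c & const_hol_sect_curv g J Rm c) /\
      (alpha_nonpositive e (3 / 2 * (m%:R ^+ 2 - 1)) Rm ->
         exists2 c : R, c <= 0 & const_hol_sect_curv g J Rm c),
      (* (2) *)
      [/\ alpha_nonnegative e (alpha_m R m) Rm ->
            orth_bisect_curv g J Rm (>= 0) /\ hol_sect_curv J Rm (>= 0),
          alpha_positive e (alpha_m R m) Rm ->
            orth_bisect_curv g J Rm (> 0) /\ hol_sect_curv J Rm (> 0),
          alpha_nonpositive e (alpha_m R m) Rm ->
            orth_bisect_curv g J Rm (<= 0) /\ hol_sect_curv J Rm (<= 0)
        & alpha_negative e (alpha_m R m) Rm ->
            orth_bisect_curv g J Rm (< 0) /\ hol_sect_curv J Rm (< 0)],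
      (* (3) *)
      [/\ alpha_nonnegative e (beta_m R m) Rm ->
            orth_ric_curv g J e Rm (>= 0),
          alpha_positive e (beta_m R m) Rm ->
            orth_ric_curv g J e Rm (> 0),
          alpha_nonpositive e (beta_m R m) Rm ->
            orth_ric_curv g J e Rm (<= 0)
        & alpha_negative e (beta_m R m) Rm ->
            orth_ric_curv g J e Rm (< 0)]
    & (* (4) *)
      [/\ alpha_nonnegative e (gamma_m R m) Rm ->
            mixed_ric_curv g J e Rm (>= 0),
          alpha_positive e (gamma_m R m) Rm ->
            mixed_ric_curv g J e Rm (> 0),
          alpha_nonpositive e (gamma_m R m) Rm ->
            mixed_ric_curv g J e Rm (<= 0)
        & alpha_negative e (gamma_m R m) Rm ->
            mixed_ric_curv g J e Rm (< 0)]].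
Proof.
move=> m2 _ csJ onbe kR; have kN := kahler_opp_curvature kR.
split.
- split=> [nn|nn]; first exact: (const_hol_sect_of_nonnegative m2 csJ onbe kR).
  have [c c0 cst] := const_hol_sect_of_nonnegative m2 csJ onbe kN nn.
  by exists (- c); rewrite ?oppr_le0 // => X /cst <-; rewrite opprK.
- split=> [nn|nn|nn|nn]; split=> [X Y X0 Y0 XY XJY|X X0] /=.
  + apply: alpha_controls_ge0 nn.
    exact: (alpha_controls_orth_bisect m2 csJ onbe kR).
  + by apply: alpha_controls_ge0 nn; exact: (alpha_controls_hol m2 csJ onbe kR).
  + apply: alpha_controls_gt0 nn.
    exact: (alpha_controls_orth_bisect m2 csJ onbe kR).
  + by apply: alpha_controls_gt0 nn; exact: (alpha_controls_hol m2 csJ onbe kR).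
  (* The alpha-conditions with reversed sign are conditions on [opp_curvature Rm], whose curvature
     quantities are the negatives of those of Rm. *)
  + rewrite -oppr_ge0; apply: alpha_controls_ge0 nn.
    exact: (alpha_controls_orth_bisect m2 csJ onbe kN).
  + rewrite -oppr_ge0; apply: alpha_controls_ge0 nn.
    exact: (alpha_controls_hol m2 csJ onbe kN).
  + rewrite -oppr_gt0; apply: alpha_controls_gt0 nn.
    exact: (alpha_controls_orth_bisect m2 csJ onbe kN).
  + rewrite -oppr_gt0; apply: alpha_controls_gt0 nn.
    exact: (alpha_controls_hol m2 csJ onbe kN).
- have cN X : X != 0 -> alpha_controls e (opp_curvature Rm) (beta_m R m)
      (- (Ric e Rm X X - Rm X (J X) X (J X) / g X X)).
    move=> /(alpha_controls_orth_ric m2 csJ onbe kN).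
    by rewrite Ric_opp_curvature mulNr -opprD.
  split=> nn X X0 /=.
  + apply: alpha_controls_ge0 nn; exact: (alpha_controls_orth_ric m2 csJ onbe kR).
  + apply: alpha_controls_gt0 nn; exact: (alpha_controls_orth_ric m2 csJ onbe kR).
  + by rewrite -oppr_ge0; apply: alpha_controls_ge0 nn; exact: cN.
  + by rewrite -oppr_gt0; apply: alpha_controls_gt0 nn; exact: cN.
- have cN X : X != 0 -> alpha_controls e (opp_curvature Rm) (gamma_m R m)
      (- (2 * Ric e Rm X X - Rm X (J X) X (J X) / g X X)).
    move=> /(alpha_controls_mixed_ric m2 csJ onbe kN).
    by rewrite Ric_opp_curvature mulrN mulNr -opprD.
  split=> nn X X0 /=.
  + apply: alpha_controls_ge0 nn; exact: (alpha_controls_mixed_ric m2 csJ onbe kR).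
  + apply: alpha_controls_gt0 nn; exact: (alpha_controls_mixed_ric m2 csJ onbe kR).
  + by rewrite -oppr_ge0; apply: alpha_controls_ge0 nn; exact: cN.
  + by rewrite -oppr_gt0; apply: alpha_controls_gt0 nn; exact: cN.
Qed.
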